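(* Assume that the pair $(A,CA)$ is observable and that the pair $(A,Q_w^{1/2})$ is stabilizable. Let $L(0)\in\mathcal S$ and let $L(t)$, $t\ge 0$, be the solution of the gradient flow $$\frac{d}{dt}L(t)=-\nabla J_{\rm innov}(L(t))$$ started at $L(0)$. Then $$\lim_{t\to\infty}L(t)=L_{KF}.$$ Moreover, let $\mathcal L_0=\{L\in\mathcal S: J_{\rm innov}(L)\le J_{\rm innov}(L(0))\}$ and $$\kappa=\inf_{L\in\mathcal L_0}\lambda_{\min}(W_o(L)),\qquad c=\sup_{L\in\mathcal L_0\setminus\{L_{KF}\}}\frac{J_{\rm innov}(L)-J_{\rm innov}(L_{KF})}{\|K(L)\|_F^2}.$$ Then: 1. $\kappa>0$ and $c<\infty$; 2. for all $t\ge0$, $$J_{\rm innov}(L(t))-J_{\rm innov}(L_{KF})\le e^{-4(\kappa^2/c)t}\bigl(J_{\rm innov}(L(0))-J_{\rm innov}(L_{KF})\bigr).$$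
   Context: System. $x_{t+1}=A x_t+w_t$, $y_{t+1}=Cx_{t+1}+v_{t+1}$, with $x_t\in\mathbb{R}^n$, $y_t\in\mathbb{R}^p$, $A\in\mathbb{R}^{n\times n}$, $C\in\mathbb{R}^{p\times n}$. The noises $(w_t)$ and $(v_t)$ are i.i.d. zero-mean sequences, independent of each other, with covariances $\mathbb{E}[w_tw_t^{\top}]=Q_w\succ 0$ and $\mathbb{E}[v_tv_t^{\top}]=R_v\succ0$; the initial state and initial estimate have finite second moments and are independent of the noises. Filter. For a gain $L\in\mathbb{R}^{n\times p}$: $\hat x_{t+1}^-=A\hat x_t$, $\delta_{t+1}=y_{t+1}-C\hat x_{t+1}^-$ (innovation), $\hat x_{t+1}=\hat x_{t+1}^-+L\delta_{t+1}$. The estimation error is $e_t=x_t-\hat x_t$. Notation. $F(L)=(I-LC)A$; $\mathcal S=\{L\in\mathbb{R}^{n\times p}: \rho(F(L))<1\}$, where $\rho$ is the spectral radius. For $L\in\mathcal S$ the following limits exist: $\Sigma_\delta(L)=\lim_{t\to\infty}\mathbb{E}[\delta_t\delta_t^{\top}]$ and $K(L)=\lim_{t\to\infty}\mathbb{E}[e_t\delta_t^{\top}]$. The innovations loss is $J_{\rm innov}:\mathcal S\to\mathbb{R}$, $J_{\rm innov}(L)=\operatorname{Tr}(\Sigma_\delta(L))$. For $L\in\mathcal S$, $W_o(L)$ is the unique positive semidefinite solution of $W_o(L)=F(L)^{\top}W_o(L)F(L)+A^{\top}C^{\top}CA$. $\nabla J_{\rm innov}$ is the gradient with respect to the Frobenius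 inner product on $\mathbb{R}^{n\times p}$. The Kalman gain $L_{KF}\in\mathcal S$ is the gain minimizing the steady-state mean-square estimation error $\lim_{t\to\infty}\mathbb{E}\|e_t\|_2^2$ over $L\in\mathcal S$; it exists and is unique under the assumptions of the theorem. $\lambda_{\min}$ denotes the smallest eigenvalue and $\|\cdot\|_F$ the Frobenius norm. In the degenerate case $L(0)=L_{KF}$ the supremum defining $c$ is over the empty set, and item 2 is understood as the trivial statement $0\le 0$. *)

(* Defs.v *)
From HB Require Import structures.
From mathcomp Require Import all_boot all_order all_algebra.
From mathcomp Require Import all_classical all_reals all_analysis.
From mathcomp.real_closed Require Import complex.

Set Implicit Arguments.
Unset Strict Implicit.
Unset Printing Implicit Defensive.

Import Order.TTheory GRing.Theory Num.Theory.
Import numFieldNormedType.Exports.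

Local Open Scope classical_set_scope.
Local Open Scope ring_scope.

Section Matrices.
Context {R : realType}.

Definition psdmx n (M : 'M[R]_n) : Prop :=
  M^T = M /\ forall x : 'cV[R]_n, 0 <= (x^T *m M *m x) 0 0.

Definition pdmx n (M : 'M[R]_n) : Prop :=
  M^T = M /\ forall x : 'cV[R]_n, x != 0 -> 0 < (x^T *m M *m x) 0 0.

Definition sqrtmx n (M : 'M[R]_n) : 'M[R]_n :=
  xget 0 [set S : 'M[R]_n | psdmx S /\ S *m S = M].

(* The supremum is a maximum when 0 < n. *)
Definition spectral_radius n (M : 'M[R]_n) : R :=
  sup [set Normc.normc z |
        z in [set z : complex R | eigenvalue (map_mx (real_complex R) M) z]].

(* Used for symmetric matrices only, whose eigenvalues are all real. *)
Definition lambda_min n (M : 'M[R]_n) : R := inf [set a : R | eigenvalue M a].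

Definition frob_dot m n (M N : 'M[R]_(m, n)) : R := \tr (M^T *m N).

Definition frob_norm m n (M : 'M[R]_(m, n)) : R := Num.sqrt (frob_dot M M).

Definition observable n q (A : 'M[R]_n) (H : 'M[R]_(q, n)) : Prop :=
  \rank (\mxcol_(k < n) (H *m A ^+ k)) = n.

Definition stabilizable n m (A : 'M[R]_n) (B : 'M[R]_(n, m)) : Prop :=
  exists K : 'M[R]_(m, n), spectral_radius (A + B *m K) < 1.

Definition is_gradient m n (f : 'M[R]_(m, n) -> R) (X G : 'M[R]_(m, n)) : Prop :=
  differentiable f X /\ forall H, 'd f X H = frob_dot G H.

Definition gradient m n (f : 'M[R]_(m, n) -> R) (X : 'M[R]_(m, n)) :
  'M[R]_(m, n) := xget 0 (is_gradient f X).

(* Curves defined on [0, +oo[ with values in S; at t = 0 the derivative is the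
   one-sided one. The values of L at negative times are irrelevant. *)
Definition gradient_flow m n (S : set 'M[R]_(m, n)) (f : 'M[R]_(m, n) -> R)
    (L : R -> 'M[R]_(m, n)) : Prop :=
  forall t, 0 <= t -> S (L t) /\
    (s - t)^-1 *: (L s - L t) @[s --> within `[0, +oo[ t^'] -->
      - gradient f (L t).

End Matrices.

Section Probability.
Context d (Omega : measurableType d) (R : realType) (P : probability Omega R).

Definition sigma_indep (F G : set (set Omega)) : Prop :=
  forall E E', F E -> G E' -> P (E `&` E') = (P E * P E')%E.

Definition mutually_indep (F : nat -> set (set Omega)) : Prop :=
  forall (s : seq nat) (E : nat -> set Omega), uniq s ->
    (forall i, i \in s -> F i (E i)) ->
    P (\big[setI/setT]_(i <- s) E i) = (\prod_(i <- s) P (E i))%E.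

Definition borel m : set (set 'cV[R]_m) := <<s [set U : set 'cV[R]_m | open U] >>.

Definition random_vector m (X : Omega -> 'cV[R]_m) : Prop :=
  forall B, borel B -> measurable (X @^-1` B).

Definition sigma_vec m (X : Omega -> 'cV[R]_m) : set (set Omega) :=
  [set X @^-1` B | B in @borel m].

Definition sigma_seq m (X : nat -> Omega -> 'cV[R]_m) : set (set Omega) :=
  <<s \bigcup_t sigma_vec (X t) >>.

Definition same_law m (X Y : Omega -> 'cV[R]_m) : Prop :=
  forall B, borel B -> P (X @^-1` B) = P (Y @^-1` B).

Definition finite_second_moment m (X : Omega -> 'cV[R]_m) : Prop :=
  forall i, P.-integrable setT (fun omega => (X omega i 0 ^+ 2)%:E).

Definition mx_expectation m n (X : Omega -> 'M[R]_(m, n)) : 'M[R]_(m, n) :=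
  \matrix_(i, j) fine ('E_P[fun omega => X omega i j]).

Record iid_noise m (w : nat -> Omega -> 'cV[R]_m) (Q : 'M[R]_m) : Prop := {
  noise_measurable : forall t, random_vector (w t);
  noise_indep : mutually_indep (fun t => sigma_vec (w t));
  noise_same_law : forall t, same_law (w t) (w 0%N);
  noise_second_moment : forall t, finite_second_moment (w t);
  noise_zero_mean : forall t, mx_expectation (w t) = 0;
  noise_covariance : forall t,
    mx_expectation (fun omega => w t omega *m (w t omega)^T) = Q }.

Record initial_data m (x0 xhat0 : Omega -> 'cV[R]_m) : Prop := {
  initial_state_measurable : random_vector x0;
  initial_estimate_measurable : random_vector xhat0;
  initial_state_second_moment : finite_second_moment x0;
  initial_estimate_second_moment : finite_second_moment xhat0 }.

(* The pair (x0, xhat0) is independent of the noises jointly; x0 and xhat0 may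
   depend on each other. *)
Definition indep_of_noises n p (x0 xhat0 : Omega -> 'cV[R]_n)
    (w : nat -> Omega -> 'cV[R]_n) (v : nat -> Omega -> 'cV[R]_p) : Prop :=
  sigma_indep <<s sigma_vec x0 `|` sigma_vec xhat0 >>
              <<s sigma_seq w `|` sigma_seq v >>.

End Probability.

Section Filter.
Context d (Omega : measurableType d) (R : realType) (P : probability Omega R).
Context (n p : nat) (A : 'M[R]_n) (C : 'M[R]_(p, n)).
Context (w : nat -> Omega -> 'cV[R]_n) (v : nat -> Omega -> 'cV[R]_p).
Context (x0 xhat0 : Omega -> 'cV[R]_n).
Implicit Types (L : 'M[R]_(n, p)) (t : nat) (omega : Omega).

Fixpoint state t omega : 'cV[R]_n :=
  if t is s.+1 then A *m state s omega + w s omega else x0 omega.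

Definition output t omega : 'cV[R]_p := C *m state t omega + v t omega.

Fixpoint estimate L t omega : 'cV[R]_n :=
  if t is s.+1 then
    let prior := A *m estimate L s omega in
    prior + L *m (output s.+1 omega - C *m prior)
  else xhat0 omega.

(* The innovation delta_t exists for t >= 1 only: [innovation L t] is
   delta_(t+1). *)
Definition innovation L t omega : 'cV[R]_p :=
  output t.+1 omega - C *m (A *m estimate L t omega).

Definition error L t omega : 'cV[R]_n := state t omega - estimate L t omega.

Definition closed_loop L : 'M[R]_n := (1%:M - L *m C) *m A.

Definition stable_gains : set 'M[R]_(n, p) :=
  [set L | spectral_radius (closed_loop L) < 1].

(* The functions below are meaningful on [stable_gains], where the limits
   exist and the Lyapunov equation has a unique solution. *)
Definition innovation_cov L : 'M[R]_p :=
  lim (mx_expectation P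
         (fun omega => innovation L t omega *m (innovation L t omega)^T)
       @[t --> \oo]).

Definition cross_cov L : 'M[R]_(n, p) :=
  lim (mx_expectation P
         (fun omega => error L t.+1 omega *m (innovation L t omega)^T)
       @[t --> \oo]).

Definition innovation_loss L : R := \tr (innovation_cov L).

Definition steady_mse L : R :=
  lim (fine ('E_P[fun omega => \sum_i error L t omega i 0 ^+ 2])
       @[t --> \oo]).

Definition kalman_gain : 'M[R]_(n, p) :=
  xget 0 [set L | stable_gains L /\
                  forall L', stable_gains L' -> steady_mse L <= steady_mse L'].

Definition obs_gramian L : 'M[R]_n :=
  xget 0 [set W : 'M[R]_n | psdmx W /\
    W = (closed_loop L)^T *m W *m closed_loop L + A^T *m C^T *m C *m A].

Definition sublevel L : set 'M[R]_(n, p) :=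
  [set L' | stable_gains L' /\ innovation_loss L' <= innovation_loss L].

Definition kappa L : R := inf [set lambda_min (obs_gramian L') | L' in sublevel L].

(* Extended division: 1 / 0 = +oo, so that a vanishing [cross_cov] with a
   positive gap would make the supremum infinite. The supremum over the empty
   set is -oo, and [fine (-oo) = 0]. *)
Definition gap_ratio L : \bar R :=
  ereal_sup [set ((innovation_loss L' - innovation_loss kalman_gain)%:E
                  / (frob_norm (cross_cov L') ^+ 2)%:E)%E
            | L' in sublevel L `\ kalman_gain].

End Filter.

(* Main.v *)
Require Import Defs.
From HB Require Import structures.
From mathcomp Require Import all_boot all_order all_algebra.
From mathcomp Require Import all_classical all_reals all_analysis.
From mathcomp Require Import measurable_realfun.
From mathcomp.real_closed Require Import complex.
From mathcomp Require Import ring lra.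

(** Write [H = C A], [F = (1 - L C) A] and let [P] be the steady-state error
    covariance, the solution of the Stein equation [P = F P F^T + N(L)]. The
    loss is [tr (H P H^T)] up to a constant. For two stabilising gains with
    [D = L' - L], expanding the Riccati map gives the exact identity
      [P' - P = F' (P' - P) F'^T - D K^T - K D^T + D Sigma D^T],
    where [K = K(L)] and [Sigma = Sigma_delta(L)]. Everything follows from it.
    By duality with the equation of the observability Gramian [W],
      [J(L') - J(L) = <W' D Sigma - 2 W' K, D>], so [grad J (L) = - 2 W K].
    Completing the square gives [J(L) - J(L') <= c |K(L)|^2] for any fixed [L'],
    and for a gain [L0] with [K(L0) = 0] it gives both minimality and
    [J(L) - J(L0) >= r tr (D^T W D)] with [D = L - L0]. Observability bounds
    [P] and [L] on sublevel sets, hence bounds [W] from below there; existence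
    of [L0] follows by minimising [tr P] over a compact set of pairs [(L, P)].
    Along the flow [J - J(L0)] then decays exponentially and dominates
    [|L - L0|^2]. *)

Set Implicit Arguments.
Unset Strict Implicit.
Unset Printing Implicit Defensive.

Import Order.TTheory GRing.Theory Num.Theory.
Import numFieldNormedType.Exports.

Local Open Scope classical_set_scope.
Local Open Scope ring_scope.

(** * Quadratic forms *)

Section QuadraticForms.
Context {R : realType}.

(** The difference identity is purely algebraic, so two stabilising gains are compared directly,
    however far apart, without a path joining them inside the non-convex set of stabilising gains.
    Comparisons are made in the semidefinite order, through the Stein equation of the second gain,
    and only then turned into numbers by traces. Two obstacles shape the rest. The loss sees the
    covariance only through [H], so a bound on the loss does not directly bound [P] or [L];
    observability has to spread it to all directions while [F(L)] is still uncontrolled. And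
    stability is an open condition, so a limit of stabilising gains could lose it; since the noise
    is positive definite, a positive semidefinite fixed point of the Riccati map is itself a
    certificate of stability, and this condition is closed. The Kalman gain is defined by the
    mean-square error, not by the loss, so the identity at a stationary gain is read twice, for
    [tr (H P H^T)] and for [tr P]. The rate comes from the chain [|grad J|^2 = 4 |W K|^2 >= 4
    kappa^2 |K|^2 >= 4 (kappa^2 / c) (J - J(L_KF))]. *)

Definition bf n (M : 'M[R]_n) (x y : 'cV[R]_n) : R := (x^T *m M *m y) 0 0.
Definition qf n (M : 'M[R]_n) (x : 'cV[R]_n) : R := bf M x x.
Definition sqn n (x : 'cV[R]_n) : R := qf 1%:M x.

Lemma bfE n (M : 'M[R]_n) x y :
  bf M x y = \sum_i \sum_j x i 0 * M i j * y j 0.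
Proof.
rewrite /bf !mxE exchange_big; apply: eq_bigr => j _.
by rewrite !mxE big_distrl /=; apply: eq_bigr => i _; rewrite !mxE.
Qed.

Lemma bfDm n (M N : 'M[R]_n) x y : bf (M + N) x y = bf M x y + bf N x y.
Proof. by rewrite /bf mulmxDr mulmxDl mxE. Qed.

Lemma bfZm n a (M : 'M[R]_n) x y : bf (a *: M) x y = a * bf M x y.
Proof. by rewrite /bf -scalemxAr -scalemxAl mxE. Qed.

Lemma bfDl n (M : 'M[R]_n) x z y : bf M (x + z) y = bf M x y + bf M z y.
Proof. by rewrite /bf linearD /= !mulmxDl mxE. Qed.

Lemma bfDr n (M : 'M[R]_n) x y z : bf M x (y + z) = bf M x y + bf M x z.
Proof. by rewrite /bf !mulmxDr mxE. Qed.

Lemma bfZl n (M : 'M[R]_n) a x y : bf M (a *: x) y = a * bf M x y.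
Proof. by rewrite /bf linearZ /= -!scalemxAl mxE. Qed.

Lemma bfZr n (M : 'M[R]_n) a x y : bf M x (a *: y) = a * bf M x y.
Proof. by rewrite /bf -scalemxAr mxE. Qed.

Lemma bf_sym n (M : 'M[R]_n) x y : M^T = M -> bf M x y = bf M y x.
Proof.
move=> Ms; have -> : bf M x y = (x^T *m M *m y)^T 0 0 by rewrite mxE.
by rewrite !trmx_mul Ms trmxK mulmxA.
Qed.

Lemma qfDm n (M N : 'M[R]_n) x : qf (M + N) x = qf M x + qf N x.
Proof. exact: bfDm. Qed.

Lemma qfZm n a (M : 'M[R]_n) x : qf (a *: M) x = a * qf M x.
Proof. exact: bfZm. Qed.

Lemma qfNm n (M : 'M[R]_n) x : qf (- M) x = - qf M x.
Proof. by rewrite -scaleN1r qfZm mulN1r. Qed.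

Lemma qfBm n (M N : 'M[R]_n) x : qf (M - N) x = qf M x - qf N x.
Proof. by rewrite qfDm qfNm. Qed.

Lemma qf_congr m n (B : 'M[R]_(n, m)) (M : 'M[R]_m) x :
  qf (B *m M *m B^T) x = qf M (B^T *m x).
Proof. by rewrite /qf /bf trmx_mul trmxK !mulmxA. Qed.

Lemma qfD n (M : 'M[R]_n) x y : M^T = M ->
  qf M (x + y) = qf M x + 2 * bf M x y + qf M y.
Proof.
by move=> Ms; rewrite /qf !bfDl !bfDr (bf_sym y x Ms); ring.
Qed.

Lemma qfZ n (M : 'M[R]_n) a x : qf M (a *: x) = a ^+ 2 * qf M x.
Proof. by rewrite /qf bfZl bfZr; ring. Qed.

Lemma qf0 n (M : 'M[R]_n) : qf M 0 = 0.
Proof. by rewrite /qf /bf mulmx0 mxE. Qed.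

Lemma sqnE n (x : 'cV[R]_n) : sqn x = \sum_i x i 0 ^+ 2.
Proof.
by rewrite /sqn /qf /bf mulmx1 mxE; apply: eq_bigr => i _; rewrite mxE expr2.
Qed.

Lemma sqn_ge0 n (x : 'cV[R]_n) : 0 <= sqn x.
Proof. by rewrite sqnE sumr_ge0 // => i _; rewrite sqr_ge0. Qed.

Lemma sqn_eq0 n (x : 'cV[R]_n) : (sqn x == 0) = (x == 0).
Proof.
apply/eqP/eqP => [|->]; last by rewrite /sqn qf0.
rewrite sqnE => /eqP; rewrite psumr_eq0 => [/allP x0|i _]; last exact: sqr_ge0.
apply/matrixP => i j; rewrite ord1 mxE; apply/eqP.
rewrite -sqrf_eq0; exact: (x0 i (mem_index_enum i)).
Qed.

Lemma sqn_gt0 n (x : 'cV[R]_n) : x != 0 -> 0 < sqn x.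
Proof. by move=> x0; rewrite lt_def sqn_ge0 sqn_eq0 x0. Qed.

Lemma coord_sqr_le_sqn n (x : 'cV[R]_n) i : x i 0 ^+ 2 <= sqn x.
Proof.
rewrite sqnE (bigD1 i) //= lerDl sumr_ge0 // => j _.
exact: sqr_ge0.
Qed.

(** An explicit substitute for the operator norm: it bounds quadratic forms and is continuous in the
    matrix. *)
Definition mxl1 m n (M : 'M[R]_(m, n)) : R := \sum_i \sum_j `|M i j|.

Lemma mxl1_ge0 m n (M : 'M[R]_(m, n)) : 0 <= mxl1 M.
Proof. by apply: sumr_ge0 => i _; apply: sumr_ge0. Qed.

Lemma qf_le_mxl1 n (M : 'M[R]_n) x : `|qf M x| <= mxl1 M * sqn x.
Proof.
rewrite /qf bfE /mxl1 big_distrl /=; apply: le_trans (ler_norm_sum _ _ _) _.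
apply: ler_sum => i _; rewrite big_distrl /=.
apply: le_trans (ler_norm_sum _ _ _) _.
apply: ler_sum => j _; rewrite !normrM mulrAC [leRHS]mulrC.
apply: ler_wpM2r => //.
have := coord_sqr_le_sqn x i; have := coord_sqr_le_sqn x j.
rewrite -(real_normK (num_real (x i 0))) -(real_normK (num_real (x j 0))).
by nra.
Qed.

Lemma psdmxD n (M N : 'M[R]_n) : psdmx M -> psdmx N -> psdmx (M + N).
Proof.
move=> [Ms M0] [Ns N0]; split=> [|x]; first by rewrite linearD /= Ms Ns.
rewrite -[leRHS]/(qf _ x) qfDm; apply: addr_ge0; [exact: M0|exact: N0].
Qed.

Lemma psdmxZ n a (M : 'M[R]_n) : 0 <= a -> psdmx M -> psdmx (a *: M).
Proof.
move=> a0 [Ms M0]; split=> [|x]; first by rewrite linearZ /= Ms.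
rewrite -[leRHS]/(qf _ x) qfZm mulr_ge0 //; exact: M0.
Qed.

Lemma psdmx_congr m n (B : 'M[R]_(n, m)) (M : 'M[R]_m) :
  psdmx M -> psdmx (B *m M *m B^T).
Proof.
move=> [Ms M0]; split=> [|x]; first by rewrite !trmx_mul trmxK Ms mulmxA.
rewrite -[leRHS]/(qf _ x) qf_congr; exact: M0.
Qed.

Lemma psdmx_congrT m n (B : 'M[R]_(m, n)) (M : 'M[R]_m) :
  psdmx M -> psdmx (B^T *m M *m B).
Proof. by move=> M0; rewrite -{2}(trmxK B); exact: psdmx_congr. Qed.

Lemma psdmx1 n : psdmx (1%:M : 'M[R]_n).
Proof. by split=> [|x]; [rewrite trmx1|exact: sqn_ge0]. Qed.

Lemma psdmx_mul_tr m n (B : 'M[R]_(n, m)) : psdmx (B *m B^T).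
Proof. by rewrite -{1}(mulmx1 B); apply/psdmx_congr/psdmx1. Qed.

Lemma pdmxW n (M : 'M[R]_n) : pdmx M -> psdmx M.
Proof.
move=> [Ms M0]; split=> // x; have [->|/M0/ltW //] := eqVneq x 0.
by rewrite mulmx0 mxE.
Qed.

Lemma psdmx_qf_ge0 n (M : 'M[R]_n) x : psdmx M -> 0 <= qf M x.
Proof. by case=> _; exact. Qed.

Lemma cauchy_schwarz_psdmx n (M : 'M[R]_n) x y : psdmx M ->
  bf M x y ^+ 2 <= qf M x * qf M y.
Proof.
move=> Mp; have [Ms _] := Mp.
have qx := psdmx_qf_ge0 x Mp; have qy := psdmx_qf_ge0 y Mp.
have q t : 0 <= qf M x + 2 * t * bf M x y + t ^+ 2 * qf M y.
  have := psdmx_qf_ge0 (x + t *: y) Mp.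
  by rewrite qfD // qfZ bfZr mulrA.
have [y0|y0] := eqVneq (qf M y) 0.
  rewrite y0 mulr0.
  have [->|b0] := eqVneq (bf M x y) 0; first by rewrite expr0n.
  (* With [qf M y = 0] the form is affine in [t]; this [t] gives it the value -1. *)
  have := q (- (qf M x + 1) / (2 * bf M x y)).
  rewrite y0 mulr0 addr0.
  rewrite (_ : 2 * _ * _ = - (qf M x + 1)); last by field.
  by lra.
have {}y0 : 0 < qf M y by rewrite lt_def y0.
have := q (- bf M x y / qf M y).
rewrite (_ : _ + _ = (qf M x * qf M y - bf M x y ^+ 2) / qf M y); last first.
  by field; rewrite gt_eqF.
by rewrite pmulr_lge0 ?invr_gt0 // subr_ge0.
Qed.

Lemma psdmx_qf_eq0 n (M : 'M[R]_n) x : psdmx M -> qf M x = 0 -> M *m x = 0.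
Proof.
move=> Mp x0; have [Ms _] := Mp; apply/eqP; rewrite -sqn_eq0.
have := cauchy_schwarz_psdmx (M *m x) x Mp; rewrite x0 mulr0.
rewrite (_ : bf M (M *m x) x = sqn (M *m x)); last first.
  by rewrite /sqn /qf /bf mulmx1 !trmx_mul !mulmxA.
by move=> h; rewrite -sqrf_eq0 eq_le h sqr_ge0.
Qed.

Lemma psdmx_unit_pdmx n (M : 'M[R]_n) : psdmx M -> M \in unitmx -> pdmx M.
Proof.
move=> Mp Mu; have [Ms M0] := Mp; split=> // x x0.
rewrite lt_def M0 andbT; apply: contra_neq x0 => /(psdmx_qf_eq0 Mp) Mx.
by rewrite -[x](mulKmx Mu) Mx mulmx0.
Qed.

Lemma pdmx_unit n (M : 'M[R]_n) : pdmx M -> M \in unitmx.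
Proof.
move=> [Ms M0]; rewrite -row_free_unit -kermx_eq0.
apply/eqP/row_matrixP => i; rewrite row0; set u := row i _.
have uM : u *m M = 0 by rewrite -row_mul mulmx_ker row0.
apply: contraTeq isT => u0.
have := M0 u^T; rewrite trmxK uM mul0mx mxE ltxx; apply.
by rewrite -(inj_eq (@trmx_inj _ _ _)) trmxK trmx0.
Qed.

(* [sqn x ^+ 2 = (x^T M (M^-1 x)) ^+ 2 <= qf M x * qf (M^-1) x] *)
Lemma pdmx_lower n (M : 'M[R]_n) : pdmx M ->
  exists2 r : R, 0 < r & forall x, r * sqn x <= qf M x.
Proof.
move=> Mpd; have Mp := pdmxW Mpd; have [Ms _] := Mp; have Mu := pdmx_unit Mpd.
pose b := mxl1 (invmx M) + 1.
have b0 : 0 < b by rewrite ltr_wpDl // mxl1_ge0.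
exists b^-1 => [|x]; first by rewrite invr_gt0.
have [->|x0] := eqVneq x 0; first by rewrite /sqn !qf0 mulr0.
have := cauchy_schwarz_psdmx x (invmx M *m x) Mp.
have -> : bf M x (invmx M *m x) = sqn x.
  by rewrite /sqn /qf /bf -mulmxA mulKVmx // mulmx1.
have -> : qf M (invmx M *m x) = qf (invmx M) x.
  by rewrite /qf /bf -mulmxA mulKVmx // trmx_mul trmx_inv Ms.
have h2 : qf (invmx M) x <= b * sqn x.
  apply: le_trans (ler_norm _) _; apply: le_trans (qf_le_mxl1 _ _) _.
  by rewrite /b mulrDl mul1r lerDl sqn_ge0.
have q0 := psdmx_qf_ge0 x Mp; have s0 := sqn_gt0 x0.
move=> h; rewrite mulrC ler_pdivrMr // -(ler_pM2r s0) -mulrA -expr2.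
by apply: le_trans h _; apply: ler_wpM2l.
Qed.

Lemma qf_delta n (M : 'M[R]_n) i : qf M (delta_mx i 0) = M i i.
Proof.
by rewrite /qf /bf trmx_delta -rowE -colE !mxE.
Qed.

Lemma bf_delta n (M : 'M[R]_n) i j : bf M (delta_mx i 0) (delta_mx j 0) = M i j.
Proof.
by rewrite /bf trmx_delta -rowE -colE !mxE.
Qed.

Lemma psdmx_tr_ge0 n (M : 'M[R]_n) : psdmx M -> 0 <= \tr M.
Proof.
move=> Mp; apply: sumr_ge0 => i _; rewrite -qf_delta.
exact: psdmx_qf_ge0.
Qed.

Lemma psdmx_entry_le n (M : 'M[R]_n) i j : psdmx M -> `|M i j| <= \tr M.
Proof.
move=> Mp; have d k : 0 <= M k k by rewrite -qf_delta; exact: psdmx_qf_ge0.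
have dt k : M k k <= \tr M.
  by rewrite /mxtrace (bigD1 k) //= lerDl sumr_ge0.
have := cauchy_schwarz_psdmx (delta_mx i 0) (delta_mx j 0) Mp.
rewrite !qf_delta bf_delta => h.
rewrite -ler_sqr ?nnegrE ?psdmx_tr_ge0 // real_normK ?num_real //.
apply: le_trans h _; rewrite expr2; exact: ler_pM.
Qed.

(** Entries of a positive semidefinite matrix are bounded by its trace, and [Z] is half the
    difference of [Y + Z] and [Y - Z]. A two-sided bound in the semidefinite order thus becomes
    entrywise. *)
Lemma psdmx_squeeze n (Y Z : 'M[R]_n) i j :
  psdmx (Y - Z) -> psdmx (Y + Z) -> `|Z i j| <= 2 * \tr Y.
Proof.
move=> h1 h2.
have -> : Z i j = ((Y + Z) i j - (Y - Z) i j) / 2 by rewrite !mxE; field.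
have := psdmx_entry_le i j h1; have := psdmx_entry_le i j h2.
have := psdmx_tr_ge0 h1; have := psdmx_tr_ge0 h2.
rewrite !linearD linearN /= !ler_norml => ? ? /andP[? ?] /andP[? ?].
by apply/andP; split; lra.
Qed.

Lemma frob_dotE m n (M N : 'M[R]_(m, n)) :
  frob_dot M N = \sum_i \sum_j M i j * N i j.
Proof.
rewrite /frob_dot /mxtrace exchange_big; apply: eq_bigr => j _.
by rewrite mxE; apply: eq_bigr => i _; rewrite mxE.
Qed.

Lemma frob_dot_ge0 m n (M : 'M[R]_(m, n)) : 0 <= frob_dot M M.
Proof.
rewrite frob_dotE; apply: sumr_ge0 => i _; apply: sumr_ge0 => j _.
by rewrite -expr2 sqr_ge0.
Qed.

Lemma frob_normK m n (M : 'M[R]_(m, n)) : frob_norm M ^+ 2 = frob_dot M M.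
Proof. by rewrite sqr_sqrtr // frob_dot_ge0. Qed.

Lemma frob_dot_eq0 m n (M : 'M[R]_(m, n)) : frob_dot M M = 0 -> M = 0.
Proof.
rewrite frob_dotE => /eqP.
rewrite psumr_eq0 => [/allP h|i _]; last first.
  by apply: sumr_ge0 => j _; rewrite -expr2 sqr_ge0.
apply/matrixP => i j; rewrite mxE; have := h i (mem_index_enum _).
rewrite psumr_eq0 => [/allP/(_ j (mem_index_enum _))|k _].
  by rewrite -expr2 sqrf_eq0 => /eqP.
by rewrite -expr2 sqr_ge0.
Qed.

Lemma entry_sqr_le_frob m n (M : 'M[R]_(m, n)) i j :
  M i j ^+ 2 <= frob_dot M M.
Proof.
rewrite frob_dotE (bigD1 i) //= (bigD1 j) //= -expr2 -addrA lerDl addr_ge0 //.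
  by apply: sumr_ge0 => k _; rewrite -expr2 sqr_ge0.
apply: sumr_ge0 => k _; apply: sumr_ge0 => l _.
by rewrite -expr2 sqr_ge0.
Qed.

Lemma tr_congr_qf m n (W : 'M[R]_n) (K : 'M[R]_(n, m)) :
  \tr (K^T *m W *m K) = \sum_j qf W (col j K).
Proof.
apply: eq_bigr => j _; rewrite -qf_delta.
by rewrite -{2}(trmxK K) qf_congr trmxK -colE.
Qed.

Lemma frob_dot_sqn m n (K : 'M[R]_(n, m)) :
  frob_dot K K = \sum_j sqn (col j K).
Proof. by rewrite -tr_congr_qf mulmx1. Qed.

Lemma tr_congr_ge m n (W : 'M[R]_n) (K : 'M[R]_(n, m)) a :
  (forall x, a * sqn x <= qf W x) -> a * frob_dot K K <= \tr (K^T *m W *m K).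
Proof.
move=> h; rewrite tr_congr_qf frob_dot_sqn big_distrr /=.
by apply: ler_sum => j _.
Qed.

Lemma tr_congr_le m n (W : 'M[R]_n) (K : 'M[R]_(n, m)) a :
  (forall x, qf W x <= a * sqn x) -> \tr (K^T *m W *m K) <= a * frob_dot K K.
Proof.
move=> h; rewrite tr_congr_qf frob_dot_sqn big_distrr /=.
by apply: ler_sum => j _.
Qed.

End QuadraticForms.

(** * Limits of matrices and the spectral radius *)

Section MatrixLimits.
Context {R : realType}.

Lemma cvg_mxP (T : Type) (F : set_system T) {FF : Filter F} m n
    (f : T -> 'M[R]_(m, n)) (M : 'M[R]_(m, n)) :
  f x @[x --> F] --> M <-> forall i j, f x i j @[x --> F] --> M i j.
Proof.
split=> [fM i j|fM].
  exact: (cvg_comp _ _ fM (@coord_continuous R m n i j M)).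
apply/cvg_ballP => e e0; near=> x; split=> //.
near: x; apply: filter_forall => i; apply: filter_forall => j.
by have /cvg_ballP/(_ _ e0) := fM i j.
Unshelve. all: by end_near. Qed.

Lemma cvg_bigsum (T : Type) (F : set_system T) {FF : Filter F} (I : finType)
    (f : I -> T -> R) (l : I -> R) :
  (forall i, f i x @[x --> F] --> l i) ->
  (\sum_i f i x) @[x --> F] --> \sum_i l i.
Proof.
move=> fl; apply: cvg_big => [|//].
exact: (@add_continuous R).
Qed.

Lemma cvg_mulmx (T : Type) (F : set_system T) {FF : Filter F} m n p
    (f : T -> 'M[R]_(m, n)) (g : T -> 'M[R]_(n, p))
    (M : 'M[R]_(m, n)) (N : 'M[R]_(n, p)) :
  f x @[x --> F] --> M -> g x @[x --> F] --> N ->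
  (f x *m g x) @[x --> F] --> M *m N.
Proof.
move=> /cvg_mxP fM /cvg_mxP gN; apply/cvg_mxP => i j.
rewrite [X in _ --> X]mxE.
under eq_cvg do rewrite mxE.
by apply: cvg_bigsum => k; apply: cvgM.
Qed.

Lemma cvg_trmx (T : Type) (F : set_system T) {FF : Filter F} m n
    (f : T -> 'M[R]_(m, n)) (M : 'M[R]_(m, n)) :
  f x @[x --> F] --> M -> (f x)^T @[x --> F] --> M^T.
Proof.
move=> /cvg_mxP fM; apply/cvg_mxP => i j.
rewrite [X in _ --> X]mxE.
by under eq_cvg do rewrite mxE; exact: fM.
Qed.

Lemma cvg_mxtrace (T : Type) (F : set_system T) {FF : Filter F} n
    (f : T -> 'M[R]_n) (M : 'M[R]_n) :
  f x @[x --> F] --> M -> \tr (f x) @[x --> F] --> \tr M.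
Proof. by move=> /cvg_mxP fM; apply: cvg_bigsum => k. Qed.

Lemma cvg_frob_dot (T : Type) (F : set_system T) {FF : Filter F} m n
    (f g : T -> 'M[R]_(m, n)) (M N : 'M[R]_(m, n)) :
  f x @[x --> F] --> M -> g x @[x --> F] --> N ->
  frob_dot (f x) (g x) @[x --> F] --> frob_dot M N.
Proof.
by move=> fM gN; apply: cvg_mxtrace; apply: cvg_mulmx => //; exact: cvg_trmx.
Qed.

Lemma cvg_mxl1 (T : Type) (F : set_system T) {FF : Filter F} m n
    (f : T -> 'M[R]_(m, n)) (M : 'M[R]_(m, n)) :
  f x @[x --> F] --> M -> mxl1 (f x) @[x --> F] --> mxl1 M.
Proof.
move=> /cvg_mxP fM; apply: cvg_bigsum => i; apply: cvg_bigsum => j.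
exact: cvg_norm.
Qed.

Lemma cvg_qf (T : Type) (F : set_system T) {FF : Filter F} n
    (f : T -> 'M[R]_n) (M : 'M[R]_n) x :
  f t @[t --> F] --> M -> qf (f t) x @[t --> F] --> qf M x.
Proof.
move=> fM; have: (x^T *m f t *m x) @[t --> F] --> x^T *m M *m x.
  by apply: cvg_mulmx (cvg_cst _); apply: cvg_mulmx fM; exact: cvg_cst.
by move/cvg_mxP; exact.
Qed.

End MatrixLimits.

Section SpectralRadius.
Context {R : realType}.
Local Notation C := (complex R).
Local Notation normc := Normc.normc.
Local Notation toC := (map_mx (real_complex R)).

(** The form of stability that the Stein equation uses. It follows from the spectral condition by
    [spectral_radius_stable]; the spectral condition itself is recovered from a Lyapunov certificate
    in [lyapunov_spectral_radius]. *)
Definition stable n (F : 'M[R]_n) : Prop :=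
  F ^+ k @[k --> \oo] --> (0 : 'M[R]_n).

(* Cayley-Hamilton argument: with [G' = (F - z) G] one has
   [F^(k+1) G = z F^k G + F^k G'], so a geometric bound for [F^k G'] of ratio
   larger than [|z|] propagates to [F^k G]. *)
Lemma geometric_bound_powers n (F : 'M[C]_n.+1) (r : R) (s : seq C)
    (G : 'M[C]_n.+1) :
  (forall z, z \in s -> normc z < r) ->
  horner_mx F (\prod_(z <- s) ('X - z%:P)) * G = 0 ->
  exists2 B : R, 0 <= B & forall k i j, normc ((F ^+ k * G) i j) <= B * r ^+ k.
Proof.
elim: s G => [|z s IH] G sr.
  rewrite big_nil rmorph1 mul1r => ->; exists 0 => // k i j.
  by rewrite mulr0 mxE Normc.normc0 mul0r.
rewrite big_cons mulrC rmorphM /= rmorphB /= horner_mx_X horner_mx_C -mulrA.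
have zr : normc z < r by apply: sr; rewrite mem_head.
move=> /IH[t ts|B B0 GB]; first by apply: sr; rewrite in_cons ts orbT.
have r0 : 0 <= normc z by case: (z) => a b; rewrite sqrtr_ge0.
have rz : 0 < r - normc z by rewrite subr_gt0.
pose S := \sum_i \sum_j normc (G i j).
have n0 (u : C) : 0 <= normc u by case: u => a b; rewrite sqrtr_ge0.
have S0 : 0 <= S by apply: sumr_ge0 => i _; apply: sumr_ge0 => j _.
(* A constant [x] survives the recursion when [|z| x + B <= r x], that is [x >= B / (r - |z|)]; the
   summand [S] covers [k = 0]. *)
exists (S + B / (r - normc z)) => [|k i j].
  by rewrite addr_ge0 // divr_ge0 // ltW.
elim: k i j => [|k IHk] i j.
  rewrite expr0 mul1r expr0 mulr1.
  apply: (@le_trans _ _ S); last by rewrite lerDl divr_ge0 // ltW.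
  rewrite /S (bigD1 i) //= (bigD1 j) //= -addrA lerDl addr_ge0 //.
    by apply: sumr_ge0.
  by apply: sumr_ge0 => ? _; apply: sumr_ge0.
have -> : F ^+ k.+1 * G = z *: (F ^+ k * G) + F ^+ k * ((F - z%:M) * G).
  rewrite mulrBl mulrBr -[z%:M * G]/(z%:M *m G) mul_scalar_mx.
  rewrite exprSr -mulrA.
  by rewrite -[F ^+ k * (z *: G)]/(F ^+ k *m (z *: G)) -scalemxAr addrC subrK.
rewrite mxE; apply: le_trans (le_normcD _ _) _.
rewrite mxE Normc.normcM.
have := IHk i j; have := GB k i j.
set a := normc _; set b := normc _ => ab bb.
have rk : 0 <= r ^+ k by rewrite exprn_ge0 // (le_trans r0) ?ltW.
apply: le_trans (lerD (ler_wpM2l r0 bb) ab) _.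
rewrite exprS [normc z * _]mulrA -mulrDl [leRHS]mulrA; apply: ler_wpM2r => //.
rewrite -subr_ge0.
have -> : (S + B / (r - normc z)) * r - (normc z * (S + B / (r - normc z)) + B)
  = S * (r - normc z) by field; rewrite gt_eqF.
by rewrite mulr_ge0 // ltW.
Qed.

Lemma spectral_radius_stable n (F : 'M[R]_n) :
  spectral_radius F < 1 -> stable F.
Proof.
case: n F => [F _|n F].
  by apply/cvg_mxP => -[].
rewrite /spectral_radius; set E := (X in sup X) => F1.
have [s] := closed_field_poly_normal (char_poly (toC F)).
rewrite (monicP (char_poly_monic _)) scale1r => cps.
have n0 (u : C) : 0 <= normc u by case: u => a b; rewrite sqrtr_ge0.
have sE z : z \in s -> E (normc z).
  move=> zs; exists z => //=.
  by rewrite eigenvalue_root_char cps root_prod_XsubC.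
have Eub : has_ubound E.
  exists (\sum_(z <- s) normc z) => _ [z /= + <-].
  rewrite eigenvalue_root_char cps root_prod_XsubC => zs.
  by rewrite (big_rem z) //= lerDl sumr_ge0.
(* A ratio strictly between all the eigenvalue moduli and 1; the maximum with 0 keeps it
   non-negative. *)
pose r := (Num.max (sup E) 0 + 1) / 2.
have r0 : 0 <= r by rewrite /r divr_ge0 // addr_ge0 // le_max lexx orbT.
have r1 : r < 1.
  rewrite /r ltr_pdivrMr // mul1r ltrD2r gt_max F1 ltr01.
  by [].
have sr z : z \in s -> normc z < r.
  move=> zs; apply: (@le_lt_trans _ _ (Num.max (sup E) 0)).
    by rewrite le_max ub_le_sup //; exact: sE.
  have : Num.max (sup E) 0 < 1 by rewrite gt_max F1 ltr01.
  by rewrite /r; set m := Num.max _ _; lra.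
have [|B B0 FB] := @geometric_bound_powers n (toC F) r s 1 sr.
  by rewrite -cps Cayley_Hamilton mul0r.
have toCX k : toC F ^+ k = toC (F ^+ k) by rewrite rmorphXn.
have {}FB k i j : `|(F ^+ k) i j| <= B * r ^+ k.
  have := FB k i j; rewrite mulr1 toCX mxE.
  by rewrite /normc /= expr0n /= addr0 sqrtr_sqr.
apply/cvg_mxP => i j; rewrite mxE; apply/norm_cvg0P.
apply: (@squeeze_cvgr _ _ _ _ (fun=> 0) (fun k => B * r ^+ k)).
- by near=> k; rewrite normr_ge0 FB.
- exact: cvg_cst.
- rewrite -[X in _ --> X](mulr0 B); apply: cvgMr.
  by apply: cvg_expr; rewrite ger0_norm.
Unshelve. all: by end_near. Qed.

(* For [v F = z v] with [v = x^T + i y^T], the real form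
   [qf P x + qf P y] is multiplied by [|z| ^ 2] under [F^T]. *)
Lemma lyapunov_spectral_radius n (P F : 'M[R]_n) :
  psdmx P -> pdmx (P - F *m P *m F^T) -> spectral_radius F < 1.
Proof.
move=> Pp Npd; have [Ps _] := Pp.
have [nu nu0 Nnu] := pdmx_lower Npd.
(* With [P <= b] and a residual of at least [nu], each eigenvalue satisfies [|z|^2 <= 1 - nu / b].
   The summand [nu] makes [b] positive and [nu / b] at most 1. One bound for all eigenvalues keeps
   their supremum strictly below 1. *)
pose b := mxl1 P + nu.
have b0 : 0 < b by rewrite ltr_wpDl // mxl1_ge0.
have Pb x : qf P x <= b * sqn x.
  apply: le_trans (ler_norm _) _; apply: le_trans (qf_le_mxl1 _ _) _.
  by rewrite /b mulrDl lerDl mulr_ge0 ?sqn_ge0 // ltW.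
have nub : nu <= b by rewrite /b lerDr mxl1_ge0.
pose q := Num.sqrt (1 - nu / b).
have q1 : q < 1.
  rewrite -sqrtr1 ltr_sqrt // ltrBlDr ltrDl divr_gt0 //.
suff eig z : eigenvalue (toC F) z -> normc z <= q.
  rewrite /spectral_radius; set E := (X in sup X).
  have [->|/set0P E0] := eqVneq E set0; first by rewrite sup0.
  apply: le_lt_trans q1; apply: ge_sup => //.
  by move=> _ [z /= + <-]; exact: eig.
move=> /eigenvalueP[v vF v0].
pose x : 'cV[R]_n := \col_i complex.Re (v 0 i).
pose y : 'cV[R]_n := \col_i complex.Im (v 0 i).
case: z vF => al be vF.
have Fx i : (F^T *m x) i 0 = al * x i 0 - be * y i 0.
  have := congr1 (fun u : 'rV[C]_n => complex.Re (u 0 i)) vF.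
  rewrite !mxE /= => e; transitivity (complex.Re (\sum_j v 0 j * toC F j i)).
    rewrite raddf_sum; apply: eq_bigr => j _; rewrite !mxE.
    by case: (v 0 j) => a c /=; rewrite mulr0 subr0 mulrC.
  by rewrite e; case: (v 0 i) => a c /=.
have Fy i : (F^T *m y) i 0 = al * y i 0 + be * x i 0.
  have := congr1 (fun u : 'rV[C]_n => complex.Im (u 0 i)) vF.
  rewrite !mxE /= => e; transitivity (complex.Im (\sum_j v 0 j * toC F j i)).
    rewrite raddf_sum; apply: eq_bigr => j _; rewrite !mxE.
    by case: (v 0 j) => a c /=; rewrite mulr0 add0r mulrC.
  by rewrite e; case: (v 0 i) => a c /=.
have {}Fx : F^T *m x = al *: x + (- be) *: y.
  by apply/matrixP => i j; rewrite ord1 Fx !mxE mulNr.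
have {}Fy : F^T *m y = al *: y + be *: x.
  by apply/matrixP => i j; rewrite ord1 Fy !mxE.
have xy0 : 0 < sqn x + sqn y.
  have [x0|/sqn_gt0 x0] := eqVneq x 0; last by rewrite ltr_wpDr ?sqn_ge0.
  have [y0|/sqn_gt0 y0] := eqVneq y 0; last by rewrite ltr_wpDl ?sqn_ge0.
  case/eqP: v0; apply/rowP => i; rewrite mxE.
  have := congr1 (fun u : 'cV[R]_n => u i 0) x0.
  have := congr1 (fun u : 'cV[R]_n => u i 0) y0.
  by rewrite !mxE; case: (v 0 i) => a c /= -> ->.
have := Nnu x; have := Nnu y.
rewrite !qfBm !qf_congr Fx Fy !qfD // !qfZ !bfZl !bfZr (bf_sym y x Ps).
have := Pb x; have := Pb y; 
have := psdmx_qf_ge0 x Pp; have := psdmx_qf_ge0 y Pp.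
move=> py px pby pbx ny nx.
rewrite /normc /q ler_sqrt; last by rewrite subr_ge0 ler_pdivrMr // mul1r.
have sxy : qf P x + qf P y <= b * (sqn x + sqn y) by lra.
have nxy : nu * (sqn x + sqn y) <=
    (1 - (al ^+ 2 + be ^+ 2)) * (qf P x + qf P y).
  by move: nx ny; rewrite sqrrN; lra.
have s0 : 0 < qf P x + qf P y.
  have : 0 < nu * (sqn x + sqn y) by rewrite mulr_gt0.
  have : 0 <= qf P x + qf P y by rewrite addr_ge0.
  rewrite le_eqVlt => /orP[/eqP e|//].
  by move: nxy; rewrite -e mulr0; lra.
rewrite lerBrDr -lerBrDl ler_pdivrMr // -(ler_pM2r xy0) -mulrA.
apply: (le_trans nxy).
rewrite ler_wpM2l //.
rewrite -(pmulr_lge0 _ s0); apply: le_trans nxy.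
by rewrite mulr_ge0 // ltW.
Qed.

End SpectralRadius.

(** * The Stein equation *)

Section Lyapunov.
Context {R : realType}.

Lemma trmx_exp n (F : 'M[R]_n) k : (F^T) ^+ k = (F ^+ k)^T.
Proof.
elim: k => [|k IH]; first by rewrite !expr0 -[1]/(1%:M) trmx1.
by rewrite exprS exprSr IH -[LHS]/(F^T *m _) -trmx_mul.
Qed.

Lemma stable_trmx n (F : 'M[R]_n) : stable F -> stable F^T.
Proof.
move=> /cvg_trmx; rewrite trmx0 /stable.
by under [X in _ -> X]eq_cvg do rewrite trmx_exp.
Qed.

Lemma cvg_congr_pow n (F X : 'M[R]_n) : stable F ->
  (F ^+ k *m X *m (F ^+ k)^T) @[k --> \oo] --> (0 : 'M[R]_n).
Proof.
move=> sF; have -> : (0 : 'M[R]_n) = 0 *m X *m (0 : 'M[R]_n)^T.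
  by rewrite !mul0mx.
apply: cvg_mulmx; last exact: cvg_trmx.
by apply: cvg_mulmx; [exact: sF|exact: cvg_cst].
Qed.

Lemma congr_pow_fixed n (F X : 'M[R]_n) k :
  X = F *m X *m F^T -> X = F ^+ k *m X *m (F ^+ k)^T.
Proof.
move=> XF; elim: k => [|k IH]; first by rewrite expr0 -[1]/(1%:M)
  trmx1 mul1mx mulmx1.
rewrite exprSr -[F ^+ k * F]/(F ^+ k *m F) trmx_mul.
transitivity (F ^+ k *m (F *m X *m F^T) *m (F ^+ k)^T); first by rewrite -XF.
by rewrite !mulmxA.
Qed.

Lemma stein_kernel n (F X : 'M[R]_n) : stable F -> X = F *m X *m F^T -> X = 0.
Proof.
move=> sF XF; have := cvg_congr_pow X sF.
under eq_cvg do rewrite -congr_pow_fixed //.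
by move=> /(cvg_lim (@norm_hausdorff _ _)) <-; rewrite lim_cst.
Qed.

(** The operator [X - F X F^T] on vectorised matrices. In finite dimension its injectivity, from
    [stein_kernel], gives existence, so the solution is a matrix inverse rather than the sum of a
    series. *)
Definition stein_mx n (F : 'M[R]_n) : 'M[R]_(n * n) :=
  1%:M - lin_mulmx F *m lin_mulmxr F^T.

Lemma mxvec_stein n (F X : 'M[R]_n) :
  mxvec X *m stein_mx F = mxvec (X - F *m X *m F^T).
Proof.
by rewrite mulmxBr mulmx1 mulmxA !mul_vec_lin /= linearB.
Qed.

Lemma stein_unit n (F : 'M[R]_n) : stable F -> stein_mx F \in unitmx.
Proof.
move=> sF; rewrite -row_free_unit -kermx_eq0.
apply/eqP/row_matrixP => i; rewrite row0; set u := row i _.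
have : u *m stein_mx F = 0 by rewrite -row_mul mulmx_ker row0.
rewrite -[u]vec_mxK mxvec_stein => /eqP; rewrite mxvec_eq0 subr_eq0 => /eqP h.
by rewrite (stein_kernel sF h) linear0.
Qed.

(* Locked: unfolding it makes matching modulo conversion very slow. *)
Definition dlyap n (F N : 'M[R]_n) : 'M[R]_n :=
  locked (vec_mx (mxvec N *m invmx (stein_mx F))).

Lemma dlyapE n (F N : 'M[R]_n) : stable F ->
  dlyap F N = F *m dlyap F N *m F^T + N.
Proof.
move=> sF; apply/eqP; rewrite addrC -subr_eq; apply/eqP/(can_inj mxvecK).
by rewrite -mxvec_stein /dlyap -lock vec_mxK mulmxKV // stein_unit.
Qed.

Lemma dlyap_unique n (F N X : 'M[R]_n) : stable F ->
  X = F *m X *m F^T + N -> X = dlyap F N.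
Proof.
move=> sF XF; apply/eqP; rewrite -subr_eq0; apply/eqP.
apply: (stein_kernel sF); rewrite mulmxBr mulmxBl {1}XF {1}(dlyapE N sF).
by rewrite opprD addrACA subrr addr0.
Qed.

(** The comparison principle behind all later inequalities between covariances: the quadratic form
    of [F^k X (F^k)^T] never exceeds that of [X] and tends to 0. Symmetry comes from uniqueness,
    since [X^T - X] solves the homogeneous equation. *)
Lemma stein_psdmx n (F X : 'M[R]_n) : stable F ->
  psdmx (X - F *m X *m F^T) -> psdmx X.
Proof.
move=> sF Ep; have [Es _] := Ep; split.
  apply/eqP; rewrite -subr_eq0; apply/eqP/(stein_kernel sF).
  have : X^T - F *m X^T *m F^T = X - F *m X *m F^T.
    by rewrite -[RHS]Es linearB /= !trmx_mul trmxK mulmxA.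
  rewrite mulmxBr mulmxBl.
  set b := F *m X^T *m _; set d := F *m X *m _ => h.
  by rewrite -[X^T](subrK b) h addrAC [X - d - X]addrAC subrr add0r addrC.
move=> x; rewrite -[leRHS]/(qf X x).
have step k : qf (F ^+ k *m X *m (F ^+ k)^T) x <= qf X x.
  elim: k => [|k IH].
    by rewrite expr0 -[1]/(1%:M) trmx1 mul1mx mulmx1.
  apply: le_trans IH; rewrite exprSr -[F ^+ k * F]/(F ^+ k *m F).
  rewrite !qf_congr trmx_mul -mulmxA -(qf_congr F) -subr_ge0 -qfBm.
  exact: psdmx_qf_ge0.
have c : qf (F ^+ k *m X *m (F ^+ k)^T) x @[k --> \oo] --> 0.
  have <- : qf (0 : 'M[R]_n) x = 0 by rewrite /qf /bf mulmx0 mul0mx mxE.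
  by apply: cvg_qf; exact: cvg_congr_pow.
rewrite -(cvg_lim (@Rhausdorff R) c); apply: limr_le.
  by apply/cvg_ex; exists 0.
by near=> k; exact: step.
Unshelve. all: by end_near.
Qed.

Lemma dlyap_psdmx n (F N : 'M[R]_n) : stable F -> psdmx N -> psdmx (dlyap F N).
Proof.
move=> sF Np; apply: (stein_psdmx sF).
by rewrite {1}(dlyapE N sF) addrAC subrr add0r.
Qed.

(** The operators [X - F X F^T] and [W - F^T W F] are adjoint for the trace pairing. *)
Lemma stein_duality n (F W G X E : 'M[R]_n) :
  W = F^T *m W *m F + G -> X = F *m X *m F^T + E -> \tr (G *m X) = \tr (W *m E).
Proof.
move=> WE XE.
have -> : G = W - F^T *m W *m F by rewrite {1}WE addrAC subrr add0r.
have -> : E = X - F *m X *m F^T by rewrite {1}XE addrAC subrr add0r.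
rewrite mulmxBl mulmxBr !linearB /=; congr (_ - _).
by rewrite -!mulmxA mxtrace_mulC !mulmxA.
Qed.

End Lyapunov.

(** * Steady-state covariances *)

Lemma trmxD (R : nmodType) m n (A B : 'M[R]_(m, n)) : (A + B)^T = A^T + B^T.
Proof. by apply/matrixP => i j; rewrite !mxE. Qed.

Lemma trmxN (R : zmodType) m n (A : 'M[R]_(m, n)) : (- A)^T = - A^T.
Proof. by apply/matrixP => i j; rewrite !mxE. Qed.

Lemma trmxZ (R : pzSemiRingType) m n a (A : 'M[R]_(m, n)) :
  (a *: A)^T = a *: A^T.
Proof. by apply/matrixP => i j; rewrite !mxE. Qed.

Ltac mxexpand :=
  rewrite ?(trmxD, trmxN, trmxZ, trmx_mul, trmxK); rewrite ?trmx1;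
  rewrite ?(mulmxDl, mulmxDr, mulNmx, mulmxN, opprD, opprK);
  rewrite ?mulmxA.

(* Matrix products become atoms, so that [ring] applies entrywise. *)
Ltac mxabel :=
  repeat (let m := fresh "m" in set m := (_ *m _); move: m => m);
  repeat (let m := fresh "m" in set m := (_^T); move: m => m);
  apply/matrixP => ? ?; rewrite !mxE.

Section MatrixIdentities.
Context {R : realType}.

Lemma addrBDB (U : zmodType) (a b c x : U) : a + c - x = a - b + (b + c - x).
Proof. by rewrite !addrA subrK. Qed.

Lemma addrDBDB (U : zmodType) (a b c e : U) :
  a + e - (b + c) - (a - b) = e - c.
Proof. by rewrite (opprD b) (addrACA a) (addrAC (a - b)) subrr add0r. Qed.

Lemma complete_square n p (K D : 'M[R]_(n, p)) (I : 'M[R]_p) r : r != 0 ->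
  r^-1 *: (K *m K^T) + (D *m I *m D^T - D *m K^T - K *m D^T) =
  r^-1 *: ((K - r *: D) *m (K - r *: D)^T) + D *m (I - r *: 1%:M) *m D^T.
Proof.
move=> r0; mxexpand.
rewrite -?(scalemxAl, scalemxAr) ?(mulmx1, mul1mx).
by mxabel; field.
Qed.

Lemma tr_perturbation n p (W : 'M[R]_n) (K D : 'M[R]_(n, p)) (I : 'M[R]_p) :
  W^T = W -> I^T = I ->
  \tr (W *m (D *m I *m D^T - D *m K^T - K *m D^T)) =
  frob_dot (W *m D *m I - 2 *: (W *m K)) D.
Proof.
move=> Ws Is.
have e1 : \tr (W *m (D *m K^T)) = \tr ((W *m K)^T *m D).
  by rewrite trmx_mul Ws mulmxA mxtrace_mulC mulmxA.
have e2 : \tr (W *m (K *m D^T)) = \tr ((W *m K)^T *m D).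
  rewrite -mxtrace_tr !trmx_mul trmxK Ws mxtrace_mulC !mulmxA.
  by rewrite mxtrace_mulC !mulmxA.
have e3 : \tr (W *m (D *m I *m D^T)) = \tr ((W *m D *m I)^T *m D).
  by rewrite !trmx_mul Ws Is !mulmxA -(mulmxA (W *m D)) mxtrace_mulC !mulmxA.
rewrite /frob_dot trmxD trmxN trmxZ mulmxDl mulNmx -scalemxAl mxtraceD.
rewrite [\tr (- _)]raddfN /= mxtraceZ -e2 -e3 !mulmxBr !raddfB /= e1 e2.
by ring.
Qed.

End MatrixIdentities.

Section SteadyState.
Context {R : realType} {n p : nat}.
Variables (A : 'M[R]_n) (C : 'M[R]_(p, n)) (Q : 'M[R]_n) (V : 'M[R]_p).
Hypotheses (Qpd : pdmx Q) (Vpd : pdmx V).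
Implicit Types (L D : 'M[R]_(n, p)) (X : 'M[R]_n).

Local Notation H := (C *m A).
Local Notation F := (closed_loop A C).
Local Notation S := (stable_gains A C).

(* If [X] is the covariance of [e_t], then [prior_cov X] is that of
   [A e_t + w_t], [innov X = E[delta_(t+1) delta_(t+1)^T]],
   [cross L X = E[e_(t+1) delta_(t+1)^T]] and [riccati L X] is the covariance of
   [e_(t+1)]. In the limit, [Kx] is [K(L)]; [gramian] is [W_o(L)]. *)
Definition noise_in L : 'M[R]_n :=
  (1%:M - L *m C) *m Q *m (1%:M - L *m C)^T + L *m V *m L^T.
Definition prior_cov X : 'M[R]_n := A *m X *m A^T + Q.
Definition innov X : 'M[R]_p := C *m prior_cov X *m C^T + V.
Definition cross L X : 'M[R]_(n, p) := prior_cov X *m C^T - L *m innov X.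
Definition riccati L X : 'M[R]_n := F L *m X *m (F L)^T + noise_in L.

Definition errcov L : 'M[R]_n := dlyap (F L) (noise_in L).
Definition gramian L : 'M[R]_n := dlyap (F L)^T (H^T *m H).
Definition loss L : R := \tr (innov (errcov L)).
Definition Kx L := cross L (errcov L).

Lemma closed_loopE L : F L = A - L *m H.
Proof. by rewrite /closed_loop mulmxBl mul1mx mulmxA. Qed.

Lemma stable_gain L : S L -> stable (F L).
Proof. exact: spectral_radius_stable. Qed.

(** A direction missed by the [V] term has [L^T x = 0], hence [(1 - L C)^T x = x], and there [Q] is
    positive. *)
Lemma noise_in_pd L : pdmx (noise_in L).
Proof.
have Qp := pdmxW Qpd; have Vp := pdmxW Vpd.
have [s _] : psdmx (noise_in L) by apply: psdmxD; exact: psdmx_congr.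
split=> // x x0; rewrite -[ltRHS]/(qf _ x) qfDm !qf_congr.
have [Lx|Lx] := eqVneq (L^T *m x) 0; last first.
  by rewrite ltr_wpDl ?psdmx_qf_ge0 //; exact: Vpd.2.
rewrite Lx qf0 addr0 trmxD trmx1 trmxN trmx_mul mulmxDl mul1mx.
by rewrite mulNmx -mulmxA Lx mulmx0 subr0; exact: Qpd.2.
Qed.

Lemma noise_in_psd L : psdmx (noise_in L).
Proof. exact/pdmxW/noise_in_pd. Qed.

Lemma riccati_step L D X : X^T = X ->
  riccati (L + D) X = riccati L X
    + (D *m innov X *m D^T - D *m (cross L X)^T - cross L X *m D^T).
Proof.
move=> Xs; have [Qs _] := Qpd; have [Vs _] := Vpd.
rewrite /riccati /noise_in /cross /innov /prior_cov !closed_loopE.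
mxexpand; rewrite ?(mul1mx, mulmx1) Xs Qs Vs.
mxabel; ring.
Qed.

Lemma errcovE L : S L -> errcov L = riccati L (errcov L).
Proof. by move=> LS; apply: dlyapE; exact: stable_gain. Qed.

Lemma errcov_psd L : S L -> psdmx (errcov L).
Proof.
by move=> LS; apply: dlyap_psdmx (noise_in_psd L); exact: stable_gain.
Qed.

(** The residual [X - F X F^T] equals [noise_in L], which is positive definite, so [X] is a Lyapunov
    certificate. The open condition [S L] is thereby implied by closed ones, as the compactness
    argument requires. *)
Lemma errcov_unique L X : psdmx X -> X = riccati L X -> S L /\ X = errcov L.
Proof.
move=> Xp XE.
have LS : S L.
  apply: (lyapunov_spectral_radius Xp).
  by rewrite {1}XE /riccati addrAC subrr add0r; exact: noise_in_pd.
by split=> //; apply: dlyap_unique => //; exact: stable_gain.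
Qed.

Lemma gramianE L : S L ->
  gramian L = (F L)^T *m gramian L *m F L + H^T *m H.
Proof.
move=> LS; rewrite {1}/gramian dlyapE ?trmxK //.
exact/stable_trmx/stable_gain.
Qed.

Lemma gramian_psd L : S L -> psdmx (gramian L).
Proof.
move=> LS; apply: dlyap_psdmx; first exact/stable_trmx/stable_gain.
by have := psdmx_mul_tr H^T; rewrite trmxK.
Qed.

Lemma errcov_diff L D : S L -> S (L + D) ->
  errcov (L + D) - errcov L =
  F (L + D) *m (errcov (L + D) - errcov L) *m (F (L + D))^T
  + (D *m innov (errcov L) *m D^T - D *m (Kx L)^T - Kx L *m D^T).
Proof.
move=> LS LDS; have [Xs _] := errcov_psd LS.
have := riccati_step L D Xs; rewrite -errcovE // /riccati => h.
rewrite mulmxBr mulmxBl {1}errcovE // /riccati.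
set E := (X in _ = _ + X).
have -> : E = F (L + D) *m errcov L *m (F (L + D))^T + noise_in (L + D)
    - errcov L by rewrite h addrAC subrr add0r.
exact: addrBDB.
Qed.

Lemma loss_diff L L' :
  loss L' - loss L = \tr (H^T *m H *m (errcov L' - errcov L)).
Proof.
rewrite /loss -raddfB /= -[in RHS]mulmxA mxtrace_mulC; congr mxtrace.
rewrite /innov /prior_cov.
move: (errcov _) (errcov _) => X' X; mxexpand.
by mxabel; ring.
Qed.

(** The Gramian is taken at the end point and the covariances at the starting point, so in the limit
    of small [D] only the Gramian varies. *)
Lemma loss_diff_gramian L D : S L -> S (L + D) ->
  loss (L + D) - loss L = frob_dot
    (gramian (L + D) *m D *m innov (errcov L) - 2 *: (gramian (L + D) *m Kx L)) D.
Proof.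
move=> LS LDS; rewrite loss_diff.
rewrite (stein_duality (gramianE LDS) (errcov_diff LS LDS)).
have [Ws _] := gramian_psd LDS.
have [Vs _] := Vpd; have [Qs _] := Qpd; have [Xs _] := errcov_psd LS.
have Is : (innov (errcov L))^T = innov (errcov L).
  by rewrite /innov /prior_cov; mxexpand; rewrite Xs Qs Vs.
exact: tr_perturbation.
Qed.

Lemma innov_psd X : psdmx X -> psdmx (innov X - V).
Proof.
move=> Xp; rewrite /innov addrK; apply: psdmx_congr.
by apply: psdmxD (pdmxW Qpd); exact: psdmx_congr.
Qed.

Lemma innov_lower X (r : R) : psdmx X -> (forall x, r * sqn x <= qf V x) ->
  psdmx (innov X - r *: 1%:M).
Proof.
move=> Xp Vr; rewrite -(subrK V (innov X)) -addrA.
apply: psdmxD; first exact: innov_psd.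
split=> [|x]; first by rewrite trmxD trmxN trmxZ trmx1 Vpd.1.
by rewrite -[leRHS]/(qf _ x) qfBm qfZm subr_ge0 Vr.
Qed.

(* Completing the square with weight [r]: the residual of
   [r^-1 K K^T] against the perturbation is
   [r^-1 (K - r D) (K - r D)^T + D (innov - r) D^T]. *)
Lemma gradient_dominance L L' (r : R) : 0 < r ->
  (forall x, r * sqn x <= qf V x) ->
  S L -> S L' ->
  loss L - loss L' <= r^-1 * \tr ((Kx L)^T *m gramian L' *m Kx L).
Proof.
move=> r0 Vr LS; rewrite -[L'](subrKC L); move: (L' - L) => D LDS.
set W := gramian _; set K := Kx L.
pose Y := dlyap (F (L + D)) (r^-1 *: (K *m K^T)).
have sF := stable_gain LDS.
have YX : psdmx (Y + (errcov (L + D) - errcov L)).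
  apply: (stein_psdmx sF); set X := errcov _ - _.
  have := errcov_diff LS LDS; rewrite -/X -/K => XE.
  have YE : Y = _ := dlyapE (r^-1 *: (K *m K^T)) sF; rewrite -/Y in YE.
  rewrite mulmxDr mulmxDl {1}YE {1}XE.
  rewrite addrACA [_ *m _ *m _ + _ *m _ *m _ + _]addrC addrK.
  rewrite complete_square ?gt_eqF //; apply: psdmxD.
    by apply: psdmxZ (psdmx_mul_tr _); rewrite invr_ge0 ltW.
  by apply: psdmx_congr; apply: innov_lower => //; exact: errcov_psd.
have Ht : psdmx (H *m (Y + (errcov (L + D) - errcov L)) *m H^T).
  exact: psdmx_congr.
have := psdmx_tr_ge0 Ht; rewrite mxtrace_mulC mulmxA mulmxDr linearD /=.
rewrite -loss_diff.
rewrite (stein_duality (gramianE LDS) (dlyapE (r^-1 *: (K *m K^T)) sF)).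
rewrite -scalemxAr linearZ /= -/W mulmxA mxtrace_mulC mulmxA.
by move=> h; rewrite -subr_ge0 opprB.
Qed.

(** At [Kx L0 = 0] the linear terms vanish and the difference [X] of the covariances is driven by
    [D innov D^T >= r D D^T]. Comparison with the Stein solution [Y] driven by [D D^T] gives
    [X >= r Y], and duality turns [tr (H^T H Y)] into [tr (D^T W D)]. Dropping the propagated term
    instead gives [X >= r D D^T], which is what concerns the mean-square error. *)
Lemma loss_lower L0 L (r : R) : 0 < r -> (forall x, r * sqn x <= qf V x) ->
  S L0 -> Kx L0 = 0 -> S L ->
  r * \tr ((L - L0)^T *m gramian L *m (L - L0)) <= loss L - loss L0 /\
  r * frob_dot (L - L0) (L - L0) <= \tr (errcov L) - \tr (errcov L0).
Proof.
move=> r0 Vr L0S K0; rewrite -[L](subrKC L0) (addrAC L0) subrr add0r.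
move: (L - L0) => D LDS.
have sF := stable_gain LDS.
have := errcov_diff L0S LDS.
rewrite K0 trmx0 mulmx0 mul0mx !subr0; set X := _ - _ => XE.
have Sr := innov_lower (errcov_psd L0S) Vr.
have DSD : psdmx (D *m innov (errcov L0) *m D^T - r *: (D *m D^T)).
  rewrite (_ : _ - _ = D *m (innov (errcov L0) - r *: 1%:M) *m D^T).
    exact: psdmx_congr.
  by rewrite mulmxBr mulmxBl -scalemxAr mulmx1 -scalemxAl.
have Xp : psdmx X.
  apply: (stein_psdmx sF); rewrite {1}XE addrAC subrr add0r.
  rewrite -(subrK (r *: (D *m D^T)) (_ *m D^T)).
  by apply: psdmxD => //; apply: psdmxZ (psdmx_mul_tr _); exact: ltW.
pose Y := dlyap (F (L0 + D)) (D *m D^T).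
have YE : Y = _ := dlyapE (D *m D^T) sF; rewrite -/Y in YE.
split.
  have XY : psdmx (X - r *: Y).
    apply: (stein_psdmx sF).
    rewrite (_ : _ - _ = D *m innov (errcov L0) *m D^T - r *: (D *m D^T)) //.
    rewrite {1}XE {1}YE scalerDr [_ *m (X - _)]mulmxBr mulmxBl.
    rewrite -scalemxAr -scalemxAl.
    exact: addrDBDB.
  have Ht : psdmx (H *m (X - r *: Y) *m H^T) by exact: psdmx_congr.
  have := psdmx_tr_ge0 Ht; rewrite mxtrace_mulC mulmxA mulmxBr linearB /=.
  rewrite -loss_diff -scalemxAr linearZ /= (stein_duality (gramianE LDS) YE).
  by rewrite mulmxA mxtrace_mulC mulmxA subr_ge0.
have : psdmx (X - r *: (D *m D^T)).
  rewrite {1}XE -addrA; apply: psdmxD => //; exact: psdmx_congr.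
move=> /psdmx_tr_ge0; rewrite !linearB linearZ /= mxtrace_mulC -/(frob_dot D D).
by rewrite subr_ge0.
Qed.

End SteadyState.

(** * Observability and coercivity *)

Section Observability.
Context {R : realType}.

(** Full rank means that the ranges of the matrices [(A^T)^k H^T] span the space. Used with [U u] of
    the form: some bound at [u] holds for all gains at once. Constants then need not be followed
    through the powers of [A]. *)
Lemma observable_ind n q (A : 'M[R]_n) (H : 'M[R]_(q, n))
    (U : 'cV[R]_n -> Prop) :
  observable A H -> (forall u v, U u -> U v -> U (u + v)) ->
  (forall y, U (H^T *m y)) -> (forall u, U u -> U (A^T *m u)) -> forall u, U u.
Proof.
rewrite /observable; set O := \mxcol_(k < n) _ => rO UD UH UA u.
have U0 : U 0 by rewrite -(mulmx0 _ H^T).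
have : (u^T <= O)%MS by apply: submx_full; rewrite /row_full rO.
case/submxP => D uD; rewrite -[u]trmxK uD -[D]submxrowK mul_mxrow_mxcol.
elim/big_ind: _ => [|x y Ux Uy|k _]; first by rewrite trmx0.
  by rewrite trmxD; exact: UD.
rewrite mulmxA trmx_mul trmx_mul; elim: (k : nat) => [|j IH].
  by rewrite expr0 -[1]/(1%:M) trmx1 mul1mx.
by rewrite exprSr -[_ ^+ j * A]/(_ *m A) trmx_mul -mulmxA; exact: UA.
Qed.

Lemma psdmx_qf_le_tr n (M : 'M[R]_n) x : psdmx M ->
  qf M x <= (n * n)%:R * \tr M * sqn x.
Proof.
move=> Mp; apply: le_trans (ler_norm _) _; apply: le_trans (qf_le_mxl1 _ _) _.
apply: ler_wpM2r; first exact: sqn_ge0.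
apply: (@le_trans _ _ (\sum_(i < n) \sum_(j < n) \tr M)).
  by apply: ler_sum => i _; apply: ler_sum => j _; exact: psdmx_entry_le.
by rewrite !sumr_const card_ord -mulrnA mulr_natl.
Qed.

Lemma psdmx_qfD_le n (M : 'M[R]_n) x y : psdmx M ->
  qf M (x + y) <= 2 * qf M x + 2 * qf M y.
Proof.
move=> Mp; have [Ms _] := Mp.
have := psdmx_qf_ge0 (x - y) Mp; rewrite -scaleN1r !qfD // qfZ bfZr.
lra.
Qed.

Lemma eigenvalue_unitmx n (M : 'M[R]_n) a :
  eigenvalue M a = (M - a%:M \notin unitmx).
Proof. by rewrite /eigenvalue /eigenspace kermx_eq0 row_free_unit. Qed.

(** Let [m] be the largest constant with [m |x|^2 <= qf W x]. If [W - m] were invertible it would be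
    positive definite, and [m] could be raised; so [m] is an eigenvalue, and it is below all others.
    A positive dimension supplies the unit vector that bounds these constants. *)
Lemma lambda_minP n (W : 'M[R]_n) : (0 < n)%N -> psdmx W ->
  eigenvalue W (lambda_min W) /\
  (forall x, lambda_min W * sqn x <= qf W x).
Proof.
move=> n0 Wp; have [Ws _] := Wp.
pose E := [set a : R | forall x, a * sqn x <= qf W x].
have E0 : E 0 by move=> x; rewrite mul0r psdmx_qf_ge0.
have sqn1 i : sqn (delta_mx i 0 : 'cV[R]_n) = 1.
  by rewrite /sqn qf_delta mxE eqxx.
have Eub : has_ubound E.
  exists (W (Ordinal n0) (Ordinal n0)) => a /(_ (delta_mx (Ordinal n0) 0)).
  by rewrite sqn1 mulr1 qf_delta.
pose m := sup E.
have Em : E m.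
  move=> x; have [->|x0] := eqVneq x 0; first by rewrite /sqn !qf0 mulr0.
  rewrite -ler_pdivlMr ?sqn_gt0 //; apply: ge_sup; first by exists 0.
  by move=> a /(_ x); rewrite ler_pdivlMr ?sqn_gt0.
have qWm a x : qf (W - a%:M) x = qf W x - a * sqn x.
  by rewrite -scalemx1 qfBm qfZm.
have eWm : eigenvalue W m.
  rewrite eigenvalue_unitmx; apply/negP => Wu.
  have Wmp : psdmx (W - m%:M).
    split=> [|x]; first by rewrite trmxD trmxN tr_scalar_mx Ws.
    by rewrite -[leRHS]/(qf _ x) qWm subr_ge0 Em.
  have [r r0 rW] := pdmx_lower (psdmx_unit_pdmx Wmp Wu).
  have : E (m + r).
    by move=> x; rewrite mulrDl addrC -lerBrDr -qWm.
  by move=> /(ub_le_sup Eub); rewrite -/m gerDl leNgt r0.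
have lb a : eigenvalue W a -> m <= a.
  move=> /eigenvalueP[v vW v0]; have := Em v^T.
  have -> : qf W v^T = a * sqn v^T.
    by rewrite /sqn /qf /bf trmxK vW mulmx1 -scalemxAl mxE.
  rewrite ler_pM2r // sqn_gt0 //.
  by apply: contra_neq v0 => v0; rewrite -[v]trmxK v0 trmx0.
have -> : lambda_min W = m.
  apply/eqP; rewrite eq_le; apply/andP; split.
    by apply: ge_inf => //; exists m => a; exact: lb.
  by apply: lb_le_inf; [exists m|move=> a; exact: lb].
by split.
Qed.

(** Cauchy-Schwarz: [a |x|^2 <= x^T W x <= |x| |W x|]. *)
Lemma lambda_min_sqr n (W : 'M[R]_n) a x : psdmx W -> 0 <= a ->
  (forall y, a * sqn y <= qf W y) -> a ^+ 2 * sqn x <= sqn (W *m x).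
Proof.
move=> Wp a0 aW; have [->|x0] := eqVneq x 0.
  by rewrite mulmx0 /sqn !qf0 mulr0.
have s0 := sqn_gt0 x0.
have := cauchy_schwarz_psdmx x (W *m x) (psdmx1 n).
rewrite -/(sqn x) -/(sqn (W *m x)).
have -> : bf 1%:M x (W *m x) = qf W x by rewrite /qf /bf mulmx1 mulmxA.
have := aW x; set q := qf W x => aq qs.
rewrite -(ler_pM2l s0); apply: le_trans qs.
rewrite (_ : sqn x * _ = (a * sqn x) ^+ 2); last by ring.
by rewrite ler_sqr // nnegrE ?mulr_ge0 ?sqn_ge0 ?psdmx_qf_ge0.
Qed.

End Observability.

Lemma subrDDK (U : zmodType) (x b c : U) : x - b = x - (b + c) + c.
Proof. by rewrite opprD addrA subrK. Qed.

Lemma subrDBK (U : zmodType) (x a b c : U) :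
  x - (b + c) - (a - b) = x - (a + c).
Proof. by rewrite -addrA -opprD [b + c + _]addrC addrA subrK. Qed.

Section Coercivity.
Context {R : realType} {n p : nat}.
Variables (A : 'M[R]_n) (C : 'M[R]_(p, n)) (Q : 'M[R]_n) (V : 'M[R]_p).
Hypotheses (Qpd : pdmx Q) (Vpd : pdmx V).
Hypothesis obs : observable A (C *m A).
Implicit Types (L D : 'M[R]_(n, p)) (X P : 'M[R]_n).

Local Notation H := (C *m A).
Local Notation F := (closed_loop A C).
Local Notation S := (stable_gains A C).
Local Notation riccati := (riccati A C Q V).
Local Notation errcov := (errcov A C Q V).
Local Notation innov := (innov A C Q V).
Local Notation cross := (cross A C Q V).
Local Notation gramian := (gramian A C).

Lemma riccati_qf_ge L P (r : R) u : (forall x, r * sqn x <= qf V x) ->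
  P = riccati L P ->
  qf P ((F L)^T *m u) + r * sqn (L^T *m u) <= qf P u.
Proof.
move=> Vr PE; rewrite [in leRHS]PE /riccati /noise_in !qfDm !qf_congr lerD2l.
by rewrite ler_wpDl ?Vr // psdmx_qf_ge0 //; exact: pdmxW.
Qed.

(** The level [beta] bounds [qf P] on the range of [H^T]. To pass from [u] to [A^T u], split
    [A^T u = F^T u + H^T (L^T u)]: the fixed-point equation bounds both [qf P (F^T u)] and
    [r |L^T u|^2] by [qf P u], although neither [F] nor [L] is bounded yet. Afterwards
    [r L L^T <= P] bounds the gain. *)
Lemma riccati_fixpoint_bounded (beta : R) : exists2 b : R, 0 <= b &
  forall L P, psdmx P -> P = riccati L P -> \tr (H *m P *m H^T) <= beta ->
    \tr P <= b /\ frob_dot L L <= b.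
Proof.
have [r r0 Vr] := pdmx_lower Vpd.
pose Z L P := [/\ psdmx P, P = riccati L P & \tr (H *m P *m H^T) <= beta].
have HPH L P y : Z L P ->
    qf P (H^T *m y) <= (p * p)%:R * `|beta| * sqn y.
  move=> [Pp PE Pb]; rewrite -qf_congr.
  apply: le_trans (psdmx_qf_le_tr _ (psdmx_congr _ Pp)) _.
  rewrite ler_wpM2r ?sqn_ge0 // ler_wpM2l //.
  by apply: le_trans Pb _; exact: ler_norm.
have /choice[b bP] : forall i : 'I_n, exists b : R,
    forall L P, Z L P -> qf P (delta_mx i 0) <= b.
  move=> i; move: (delta_mx i 0).
  apply: (observable_ind obs) => [u v [b ub] [c vc]|y|u [b ub]].
  - exists (2 * b + 2 * c) => L P LP.
    apply: le_trans (psdmx_qfD_le _ _ _) _; first by case: LP.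
    by apply: lerD; rewrite ler_pM2l //; [exact: (ub L)|exact: (vc L)].
  - by exists ((p * p)%:R * `|beta| * sqn y) => L P; exact: HPH.
  - exists (2 * b + 2 * ((p * p)%:R * `|beta| * (b / r))) => L P LP.
    have [Pp PE Pb] := LP.
    have := riccati_qf_ge u Vr PE; have := ub _ _ LP.
    have := psdmx_qf_ge0 ((F L)^T *m u) Pp.
    have := sqn_ge0 (L^T *m u) => s0 q0 qb qe.
    have -> : A^T *m u = (F L)^T *m u + H^T *m (L^T *m u).
      rewrite closed_loopE trmxD trmxN (trmx_mul L) mulmxDl mulNmx mulmxA.
      by rewrite subrK.
    apply: le_trans (psdmx_qfD_le _ _ Pp) _; apply: lerD.
      rewrite ler_pM2l //; apply: le_trans _ qb; apply: le_trans _ qe.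
      by rewrite lerDl mulr_ge0 // ltW.
    rewrite ler_pM2l //; apply: le_trans (HPH _ _ _ LP) _.
    rewrite ler_wpM2l ?mulr_ge0 // ler_pdivlMr // mulrC.
    by apply: le_trans _ qb; apply: le_trans _ qe; rewrite lerDr.
(* The bounds [b i] have no known sign, as there may be no pair [(L, P)] to constrain them. *)
pose t := \sum_i `|b i|.
have t0 : 0 <= t by exact: sumr_ge0.
exists (t + t / r) => [|L P Pp PE Pb].
  by rewrite addr_ge0 // divr_ge0 // ltW.
have tP : \tr P <= t.
  rewrite /mxtrace; apply: ler_sum => i _; rewrite -qf_delta.
  by apply: le_trans (bP i L P _) (ler_norm _).
split; first by apply: le_trans tP _; rewrite lerDl divr_ge0 // ltW.
apply: (@le_trans _ _ (t / r)); last by rewrite lerDr.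
rewrite ler_pdivlMr // mulrC; apply: le_trans tP.
have : psdmx (P - r *: (L *m L^T)).
  split=> [|u]; first by rewrite trmxD trmxN trmxZ trmx_mul trmxK Pp.1.
  rewrite -[leRHS]/(qf _ u) qfBm qfZm subr_ge0.
  have := riccati_qf_ge u Vr PE; have := psdmx_qf_ge0 ((F L)^T *m u) Pp.
  rewrite -{1}[L in L *m L^T]mulmx1 qf_congr -/(sqn _); lra.
move=> /psdmx_tr_ge0; rewrite linearB linearZ /= subr_ge0.
by rewrite mxtrace_mulC.
Qed.

Lemma gramian_qf L x : S L ->
  qf (gramian L) x = qf (gramian L) (F L *m x) + sqn (H *m x).
Proof.
move=> LS; rewrite {1}gramianE // qfDm -{2}(trmxK (F L)) qf_congr trmxK.
by rewrite -{2}(trmxK H) -{1}[H^T]mulmx1 qf_congr trmxK.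
Qed.

(** Each coordinate is controlled by the Gramian, in the form [(u^T x)^2 <= c * qf W x]. For the
    step to [A^T u], write [u^T A x = u^T F x + (L^T u)^T H x]; the Gramian equation bounds both
    [qf W (F x)] and [|H x|^2] by [qf W x], and the bound on the gain handles [L^T u]. *)
Lemma gramian_lower (b : R) : exists2 k : R, 0 < k &
  forall L, S L -> frob_dot L L <= b ->
    forall x, k * sqn x <= qf (gramian L) x.
Proof.
have dot_le (m : nat) (x y : 'cV[R]_m) :
    bf 1%:M x y ^+ 2 <= sqn x * sqn y.
  exact: cauchy_schwarz_psdmx (psdmx1 m).
have /choice[c cP] : forall i : 'I_n, exists c : R,
    forall L, S L -> frob_dot L L <= b -> forall x,
    bf 1%:M (delta_mx i 0) x ^+ 2 <= c * qf (gramian L) x.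
  move=> i; move: (delta_mx i 0).
  apply: (observable_ind obs) => [u v [c uc] [d vd]|y|u [c uc]].
  - exists (2 * c + 2 * d) => L LS Lb x; rewrite bfDl.
    have := uc L LS Lb x; have := vd L LS Lb x.
    have := sqr_ge0 (bf 1%:M u x - bf 1%:M v x).
    by lra.
  - exists (sqn y) => L LS _ x.
    have -> : bf 1%:M (H^T *m y) x = bf 1%:M y (H *m x).
      by rewrite /bf trmx_mul trmxK !mulmx1 mulmxA.
    apply: le_trans (dot_le _ _ _) _; rewrite ler_wpM2l ?sqn_ge0 //.
    by rewrite (gramian_qf x LS) lerDr psdmx_qf_ge0 //; exact: gramian_psd.
  - exists (2 * `|c| + 2 * ((n * n)%:R * b * sqn u)) => L LS Lb x.
    have -> : bf 1%:M (A^T *m u) x =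
        bf 1%:M u (F L *m x) + bf 1%:M (L^T *m u) (H *m x).
      rewrite /bf !(trmx_mul _ u) !trmxK !mulmx1 -!(mulmxA u^T).
      rewrite -!/(bf _ _ _); have := bfDr 1%:M u (F L *m x) (L *m (H *m x)).
      rewrite /bf mulmx1 => <-; rewrite closed_loopE mulmxBl -(mulmxA L).
      by rewrite subrK.
    have := uc L LS Lb (F L *m x); have := dot_le _ (L^T *m u) (H *m x).
    have := gramian_qf x LS.
    have Wp := gramian_psd LS.
    have := psdmx_qf_ge0 (F L *m x) Wp.
    have := psdmx_qf_ge0 x Wp.
    have := sqn_ge0 (H *m x).
    set w := qf _ x; set wF := qf _ (F L *m x); set h := sqn (H *m x).
    set s := bf _ u _; set t := bf _ (L^T *m u) _ => h0 w0 wF0 wE t2 s2.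
    have LLu : sqn (L^T *m u) <= (n * n)%:R * b * sqn u.
      rewrite /sqn -qf_congr mulmx1.
      apply: le_trans (psdmx_qf_le_tr _ (psdmx_mul_tr L)) _.
      rewrite ler_wpM2r ?sqn_ge0 // ler_wpM2l //.
      by rewrite mxtrace_mulC.
    apply: (@le_trans _ _ (2 * s ^+ 2 + 2 * t ^+ 2)).
      by have := sqr_ge0 (s - t); lra.
    rewrite [leRHS]mulrDl; apply: lerD; rewrite -mulrA ler_pM2l //.
      apply: le_trans s2 _; apply: (@le_trans _ _ (`|c| * wF)).
        by rewrite ler_wpM2r // ler_norm.
      by rewrite ler_wpM2l // wE lerDl.
    apply: le_trans t2 _; apply: ler_pM => //.
      exact: sqn_ge0.
    by rewrite wE lerDr.
pose t := \sum_i `|c i| + 1.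
have t0 : 0 < t by rewrite ltr_wpDl // sumr_ge0.
exists t^-1 => [|L LS Lb x]; first by rewrite invr_gt0.
rewrite ler_pdivrMl // sqnE /t mulrDl mul1r.
have w0 := psdmx_qf_ge0 x (gramian_psd LS).
rewrite ler_wpDr // big_distrl /=; apply: ler_sum => i _.
apply: (@le_trans _ _ (c i * qf (gramian L) x)); last first.
  by rewrite ler_wpM2r // ler_norm.
have <- : bf 1%:M (delta_mx i 0) x = x i 0.
  by rewrite /bf mulmx1 trmx_delta -rowE mxE.
exact: cP.
Qed.

(* [L'] is [L + (1 / s) cross L P], where [innov P <= s]. *)
Lemma gain_improvement L P : psdmx P -> P = riccati L P ->
  exists L', [/\ S L', psdmx (P - errcov L') &
    exists2 e : R, 0 < e &
      e * frob_dot (cross L P) (cross L P) <= \tr P - \tr (errcov L')].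
Proof.
move=> Pp PE; have [Ps _] := Pp.
move EK : (cross L P) => K.
pose s := mxl1 (innov P) + 1.
have s0 : 0 < s by rewrite ltr_wpDl // mxl1_ge0.
have sI x : s^-1 * qf (innov P) x <= sqn x.
  rewrite ler_pdivrMl //; apply: le_trans (ler_norm _) _.
  apply: le_trans (qf_le_mxl1 _ _) _.
  by rewrite /s mulrDl mul1r lerDl sqn_ge0.
have Isym : (innov P)^T = innov P.
  have [Is _] : psdmx (innov P - V) by exact: innov_psd.
  by rewrite -[innov P](subrK V) trmxD Is Vpd.1.
have := riccati_step A C Qpd Vpd L (s^-1 *: K) Ps; rewrite -PE EK.
set L' := L + _ => rE; exists L'.
pose E := P - riccati L' P.
(* The two linear terms yield [2 s^-1 K K^T]. One half pays for the quadratic term, because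
   [innov P <= s]; the other half is the gain. *)
have EK2 : psdmx (E - s^-1 *: (K *m K^T)).
  have -> : E - s^-1 *: (K *m K^T) =
      s^-1 *: (K *m (1%:M - s^-1 *: innov P) *m K^T).
    rewrite /E rE; move: (innov P) => I; mxexpand.
    rewrite -?(scalemxAl, scalemxAr) ?(mulmx1, mul1mx).
    by mxabel; ring.
  apply: psdmxZ; first by rewrite invr_ge0 ltW.
  apply: psdmx_congr; split=> [|x].
    by rewrite trmxD trmxN trmxZ trmx1 Isym.
  by rewrite -[leRHS]/(qf _ x) qfBm qfZm subr_ge0 sI.
have Ep : psdmx E.
  rewrite -(subrK (s^-1 *: (K *m K^T)) E); apply: psdmxD => //.
  by apply: psdmxZ (psdmx_mul_tr _); rewrite invr_ge0 ltW.
have res : P - F L' *m P *m (F L')^T = E + noise_in C Q V L'.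
  exact: subrDDK.
have L'S : S L'.
  apply: (lyapunov_spectral_radius Pp); rewrite res.
  have [Ns Npd] := noise_in_pd C Qpd Vpd L'.
  split=> [|x x0]; first by rewrite trmxD Ns Ep.1.
  by rewrite -[ltRHS]/(qf _ x) qfDm ltr_wpDl ?psdmx_qf_ge0 ?Npd.
have sF := stable_gain L'S.
have P'E := errcovE Q V L'S.
have resd : (P - errcov L') - F L' *m (P - errcov L') *m (F L')^T = E.
  by rewrite mulmxBr mulmxBl {1}P'E; exact: subrDBK.
have Dp : psdmx (P - errcov L') by apply: (stein_psdmx sF); rewrite resd.
split=> //; exists s^-1; first by rewrite invr_gt0.
have : psdmx (P - errcov L' - s^-1 *: (K *m K^T)).
  rewrite -[P - errcov L'](subrK (F L' *m (P - errcov L') *m (F L')^T)) resd.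
  by rewrite addrAC; apply: psdmxD => //; exact: psdmx_congr.
move=> /psdmx_tr_ge0; rewrite !linearB linearZ /= mxtrace_mulC.
by rewrite -/(frob_dot K K) subr_ge0.
Qed.

End Coercivity.

(** * Existence of the stationary gain *)

Section Existence.
Context {R : realType}.

Lemma mx_entry_le_norm m n (M : 'M[R]_(m, n)) i j : `|M i j| <= `|M|.
Proof.
rewrite [leRHS]/Num.norm /= mx_normrE.
by apply/bigmax_geP; right; exists (i, j).
Qed.

Lemma mx_norm_le m n (M : 'M[R]_(m, n)) b : 0 <= b ->
  (forall i j, `|M i j| <= b) -> `|M| <= b.
Proof.
move=> b0 Mb; rewrite [leLHS]/Num.norm /= mx_normrE.
by apply/bigmax_leP; split=> // -[i j] _; exact: Mb.
Qed.

Lemma closed_preimage (T : topologicalType) (f : T -> R) (D : set R) :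
  (forall x, f y @[y --> nbhs x] --> f x) -> closed D -> closed (f @^-1` D).
Proof. by move=> fc; apply: preimage_closed => x _; exact: fc. Qed.

Lemma closed_mx_eq0 (T : topologicalType) m n (f : T -> 'M[R]_(m, n)) :
  (forall x, f y @[y --> nbhs x] --> f x) -> closed [set x | f x = 0].
Proof.
move=> fc; rewrite (_ : mkset _ =
    \bigcap_(ij in [set: 'I_m * 'I_n]) ((fun x => f x ij.1 ij.2) @^-1` [set 0])).
  apply: closed_bigI => -[i j] _; apply: closed_preimage => [x|].
    by have /cvg_mxP := fc x; exact.
  by rewrite (_ : [set 0] = [set x | x = 0]) //; exact: closed_eq.
apply/seteqP; split=> [x /= xf [i j] _|x /= h]; first by rewrite /= xf mxE.
by apply/matrixP => i j; rewrite mxE; exact: (h (i, j)).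
Qed.

Lemma closed_psdmx (T : topologicalType) n (f : T -> 'M[R]_n) :
  (forall x, f y @[y --> nbhs x] --> f x) -> closed [set x | psdmx (f x)].
Proof.
move=> fc; rewrite (_ : mkset _ = [set x | (f x)^T - f x = 0] `&`
   \bigcap_(u in [set: 'cV[R]_n]) ((fun x => qf (f x) u) @^-1` [set y | 0 <= y])).
  apply: closedI.
    by apply: closed_mx_eq0 => x; apply: cvgB => //; apply: cvg_trmx.
  apply: closed_bigI => u _; apply: closed_preimage => [x|]; last exact: closed_ge.
  exact: cvg_qf.
apply/seteqP; split=> x /= [fs f0].
  by split=> [|u _]; [rewrite fs subrr|exact: f0].
by split=> [|u]; [apply/eqP; rewrite -subr_eq0 fs|exact: f0].
Qed.

Lemma vec_mx_entry m n (z : 'rV[R]_(m * n)) i j :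
  vec_mx z i j = z 0 (mxvec_index i j).
Proof. by rewrite -{2}[z]vec_mxK mxvecE. Qed.

Lemma cvg_vec_mx m n (z : 'rV[R]_(m * n)) :
  vec_mx y @[y --> nbhs z] --> (vec_mx z : 'M[R]_(m, n)).
Proof.
apply/cvg_mxP => i j; rewrite vec_mx_entry.
by under eq_cvg do rewrite vec_mx_entry; exact: coord_continuous.
Qed.

Lemma mxvec_norm_le m n (M : 'M[R]_(m, n)) b : 0 <= b ->
  (forall i j, `|M i j| <= b) -> `|mxvec M| <= b.
Proof.
move=> b0 Mb; apply: mx_norm_le => // i k; rewrite ord1.
by case/mxvec_indexP: k => i' j'; rewrite mxvecE.
Qed.

Context {n p : nat}.
Variables (A : 'M[R]_n) (C : 'M[R]_(p, n)) (Q : 'M[R]_n) (V : 'M[R]_p).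
Hypotheses (Qpd : pdmx Q) (Vpd : pdmx V).
Hypothesis obs : observable A (C *m A).

Local Notation H := (C *m A).
Local Notation F := (closed_loop A C).
Local Notation S := (stable_gains A C).
Local Notation riccati := (riccati A C Q V).
Local Notation errcov := (errcov A C Q V).
Local Notation Kx := (Kx A C Q V).

Lemma cvg_closed_loop (T : Type) (G : set_system T) {FG : Filter G}
    (f : T -> 'M[R]_(n, p)) (L : 'M[R]_(n, p)) :
  f x @[x --> G] --> L -> F (f x) @[x --> G] --> F L.
Proof.
move=> fL; apply: cvg_mulmx; last exact: cvg_cst.
by apply: cvgB; [exact: cvg_cst|apply: cvg_mulmx => //; exact: cvg_cst].
Qed.

Lemma cvg_riccati (T : Type) (G : set_system T) {FG : Filter G}
    (f : T -> 'M[R]_(n, p)) (g : T -> 'M[R]_n) (L : 'M[R]_(n, p)) (P : 'M[R]_n) :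
  f x @[x --> G] --> L -> g x @[x --> G] --> P ->
  riccati (f x) (g x) @[x --> G] --> riccati L P.
Proof.
move=> fL gP.
have fF : F (f x) @[x --> G] --> F L by exact: cvg_closed_loop.
have fC : (1%:M - f x *m C) @[x --> G] --> 1%:M - L *m C.
  by apply: cvgB; [exact: cvg_cst|apply: cvg_mulmx => //; exact: cvg_cst].
apply: cvgD; first by apply: cvg_mulmx (cvg_trmx fF); exact: cvg_mulmx fF gP.
apply: cvgD; (apply: cvg_mulmx; last exact: cvg_trmx);
  by apply: cvg_mulmx => //; exact: cvg_cst.
Qed.

(* The minimum of the trace is attained on the closed bounded set of pairs
   (gain, fixed point of its Riccati map) below a level of the loss; stability
   of the gain is automatic there. By [gain_improvement] the cross covariance
   vanishes at a minimiser. *)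
Lemma kalman_gain_exists L0 : S L0 -> exists2 L, S L & Kx L = 0.
Proof.
move=> L0S; pose beta := \tr (H *m errcov L0 *m H^T).
have [b b0 Zb] := riccati_fixpoint_bounded Qpd Vpd obs beta.
(* A pair (gain, covariance) is flattened into one row vector, so that closed bounded sets of pairs
   are compact. *)
pose gn (z : 'rV[R]_(n * (p + n))) : 'M[R]_(n, p) := lsubmx (vec_mx z).
pose cv (z : 'rV[R]_(n * (p + n))) : 'M[R]_n := rsubmx (vec_mx z).
pose Z := [set z | psdmx (cv z)] `&` [set z | cv z - riccati (gn z) (cv z) = 0]
  `&` (fun z => \tr (H *m cv z *m H^T)) @^-1` [set y | y <= beta].
have gnc z : gn y @[y --> nbhs z] --> gn z.
  apply/cvg_mxP => i j; rewrite mxE; under eq_cvg do rewrite mxE.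
  by have /cvg_mxP := @cvg_vec_mx n (p + n) z; exact.
have cvc z : cv y @[y --> nbhs z] --> cv z.
  apply/cvg_mxP => i j; rewrite mxE; under eq_cvg do rewrite mxE.
  by have /cvg_mxP := @cvg_vec_mx n (p + n) z; exact.
have ZP L P : psdmx P -> P = riccati L P -> \tr (H *m P *m H^T) <= beta ->
    Z (mxvec (row_mx L P)).
  move=> Pp PE Pb; rewrite /Z /gn /cv /= mxvecK row_mxKl row_mxKr.
  by rewrite -PE subrr.
have Z0 : Z !=set0.
  exists (mxvec (row_mx L0 (errcov L0))); apply: ZP => //.
    exact: errcov_psd.
  exact: errcovE.
have Zcompact : compact Z.
  apply: bounded_closed_compact.
    exists (b + 1); split; first exact: num_real.
    move=> x xb z [[/= zp /eqP]]; rewrite subr_eq0 => /eqP zE zb.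
    have [tb fb] := Zb _ _ zp zE zb; apply: le_trans (ltW xb).
    rewrite -[z]vec_mxK; apply: mxvec_norm_le; first by rewrite addr_ge0.
    move=> i j; rewrite -[vec_mx z]hsubmxK -/(gn z) -/(cv z) mxE.
    case: splitP => k _.
      have := entry_sqr_le_frob (gn z) i k.
      rewrite -(real_normK (num_real _)); have := normr_ge0 (gn z i k).
      by nra.
    apply: le_trans (psdmx_entry_le _ _ zp) _; apply: le_trans tb _.
    by rewrite lerDl.
  apply: closedI; [apply: closedI|].
  - exact: closed_psdmx.
  - apply: closed_mx_eq0 => z; apply: cvgB => //.
    exact: cvg_riccati.
  - apply: closed_preimage => [z|]; last exact: closed_le.
    apply: cvg_mxtrace.
    apply: cvg_mulmx; last exact: cvg_cst.
    by apply: cvg_mulmx => //; exact: cvg_cst.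
have [|z] := @compact_EVT_min _ _ (fun z => \tr (cv z)) Z Z0 Zcompact.
  by apply: continuous_subspaceT => z; apply: (@cvg_mxtrace R _ (nbhs z)).
rewrite inE => -[[/= zp /eqP]]; rewrite subr_eq0 => /eqP zE zb zmin.
have [zS zcov] := errcov_unique Qpd Vpd zp zE.
exists (gn z) => //; rewrite /Kx -zcov.
have [L' [L'S dp [e e0 eK]]] := gain_improvement Qpd Vpd zp zE.
(* The improved covariance is below the old one in the semidefinite order, so its pair is again in
   [Z], and minimality leaves no room for a positive decrease of the trace. *)
have L'Z : Z (mxvec (row_mx L' (errcov L'))).
  apply: ZP; [exact: errcov_psd|exact: errcovE|].
  apply: le_trans zb; rewrite -subr_ge0 -raddfB /= -mulmxBl -mulmxBr.
  exact/psdmx_tr_ge0/psdmx_congr.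
apply: frob_dot_eq0; apply/eqP; rewrite eq_le frob_dot_ge0 andbT.
rewrite -(ler_pM2l e0) mulr0; apply: le_trans eK _; rewrite subr_le0.
have := zmin _ (mem_set L'Z).
by rewrite /cv mxvecK row_mxKr.
Qed.

End Existence.

(** * Gradient of the loss *)

Section Gradient.
Context {R : realType}.

Lemma frob_dot_linear m n (G : 'M[R]_(m, n)) : linear (frob_dot G : _ -> R^o).
Proof.
by move=> a X Y; rewrite /frob_dot mulmxDr -scalemxAr linearD linearZ.
Qed.

HB.instance Definition _ m n (G : 'M[R]_(m, n)) :=
  GRing.isLinear.Build R 'M[R]_(m, n) R^o *:%R (frob_dot G)
    (frob_dot_linear G).

Lemma frob_dot_norm_le m n (M N : 'M[R]_(m, n)) :
  `|frob_dot M N| <= mxl1 M * `|N|.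
Proof.
rewrite frob_dotE /mxl1 big_distrl; apply: le_trans (ler_norm_sum _ _ _) _.
apply: ler_sum => i _; rewrite big_distrl.
apply: le_trans (ler_norm_sum _ _ _) _; apply: ler_sum => j _ /=.
by rewrite normrM ler_wpM2l // mx_entry_le_norm.
Qed.

Lemma frob_dot_eq m n (M N : 'M[R]_(m, n)) :
  (forall D, frob_dot M D = frob_dot N D) -> M = N.
Proof.
move=> MN; apply/eqP; rewrite -subr_eq0; apply/eqP/frob_dot_eq0.
rewrite {1}/frob_dot trmxD trmxN mulmxBl linearB /=.
by rewrite -!/(frob_dot _ (M - N)) MN subrr.
Qed.

(** Caratheodory's form of differentiability: for an exact secant identity, a limit of the slope is
    enough. For the loss this reduces everything to continuity of the Gramian. *)
Lemma slope_is_gradient m n (f : 'M[R]_(m, n) -> R)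
    (G : 'M[R]_(m, n) -> 'M[R]_(m, n)) X g :
  (\forall Y \near nbhs X, f Y - f X = frob_dot (G Y) (Y - X)) ->
  G Y @[Y --> nbhs X] --> g -> is_gradient f X g.
Proof.
move=> fG Gg.
have gc : continuous (frob_dot g : _ -> R^o).
  move=> Y; apply: (@cvg_frob_dot R _ (nbhs Y)) => //; exact: cvg_cst.
have shX : (h + X) @[h --> nbhs (0 : 'M[R]_(m, n))] --> X.
  rewrite -[X in _ --> X]add0r; apply: cvgD; first exact: cvg_id.
  exact: cvg_cst.
have fo : (f : _ -> R^o) \o shift X =
    cst (f X) + (frob_dot g : _ -> R^o) +o_ (0 : 'M[R]_(m, n)) id.
  apply/eqaddoP => e e0.
  have Ge : \forall Y \near nbhs X, mxl1 (G Y - g) < e.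
    have : mxl1 (G Y - g) @[Y --> nbhs X] --> mxl1 (g - g).
      by apply: cvg_mxl1; apply: cvgB => //; exact: cvg_cst.
    rewrite subrr [X in _ --> X](_ : _ = 0); last first.
      by rewrite /mxl1 big1 // => i _; rewrite big1 // => j _; rewrite mxE normr0.
    by move=> /cvgr_lt; apply.
  have {}fG := shX _ fG; have {}Ge := shX _ Ge.
  near=> h.
  rewrite !fctE /= opprD addrA.
  have -> : f (h + X) - f X = frob_dot (G (h + X)) h.
    have -> : f (h + X) - f X = frob_dot (G (h + X)) (h + X - X) by near: h.
    by rewrite addrK.
  have -> : frob_dot (G (h + X)) h - frob_dot g h = frob_dot (G (h + X) - g) h.
    by rewrite /frob_dot trmxD trmxN mulmxBl linearB.
  apply: le_trans (frob_dot_norm_le _ _) _; apply: ler_wpM2r => //.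
  by apply: ltW; near: h.
have dfE : 'd (f : _ -> R^o) X = frob_dot g :> (_ -> _).
  exact: diff_unique.
split; last by move=> D; rewrite dfE.
by apply/diff_locallyP; rewrite dfE; split.
Unshelve. all: by end_near. Qed.

Lemma is_gradientE m n (f : 'M[R]_(m, n) -> R) X g :
  is_gradient f X g -> gradient f X = g.
Proof.
move=> fg; have [_ gE] := fg; apply: frob_dot_eq => D.
have [_ <-] : is_gradient f X (gradient f X) by apply: (@xgetPex _ 0); exists g.
exact: gE.
Qed.

End Gradient.

(** * Continuity of the observability Gramian in the gain *)

Lemma addrDBDB2 (U : zmodType) (a b c h : U) :
  a + h - (b + h) - (a - c) = c - b.
Proof.
by rewrite (opprD b) (addrACA a) subrr addr0 opprB [a - b + _]addrC addrA subrK.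
Qed.

Section SteinPerturbation.
Context {R : realType} {n : nat}.
Implicit Types F Y W G : 'M[R]_n.

Lemma trmx_stein_residual F Y : Y^T = Y ->
  (Y - F^T *m Y *m F)^T = Y - F^T *m Y *m F.
Proof. by move=> Ys; rewrite trmxD trmxN !trmx_mul trmxK mulmxA Ys. Qed.

(** The difference [Z = W' - W] solves a Stein equation for [F'] whose source is at most [e] in
    size, while [Y] has a source of at least 1/2. By comparison both [2 e Y + Z] and [2 e Y - Z] are
    positive semidefinite, and [psdmx_squeeze] gives the factor 4. *)
Lemma stein_perturbation F F' Y W W' G (e : R) i j : stable F'^T -> psdmx Y ->
  W^T = W -> W'^T = W' ->
  W = F^T *m W *m F + G -> W' = F'^T *m W' *m F' + G ->
  (forall x, 2^-1 * sqn x <= qf (Y - F'^T *m Y *m F') x) ->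
  mxl1 (F'^T *m W *m F' - F^T *m W *m F) <= e ->
  `|W i j - W' i j| <= 4 * e * \tr Y.
Proof.
move=> sF' Yp Ws W's WE W'E Ylb dW; have [Ys _] := Yp.
have e0 : 0 <= e by apply: le_trans dW; exact: mxl1_ge0.
have : (W' - W) - F'^T *m (W' - W) *m F' = F'^T *m W *m F' - F^T *m W *m F.
  by rewrite mulmxBr mulmxBl {1}W'E {1}WE; exact: addrDBDB2.
have : (W' - W)^T = W' - W by rewrite trmxD trmxN W's Ws.
have -> : W i j - W' i j = - (W' - W) i j by rewrite !mxE opprB.
rewrite normrN; move: (F'^T *m W *m F' - _) dW (W' - W) => D dW Z Zs res.
have Dle x : `|qf D x| <= e * sqn x.
  by apply: le_trans (qf_le_mxl1 _ _) _; rewrite ler_wpM2r ?sqn_ge0.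
have squeeze (s : R) : `|s| = 1 -> psdmx ((2 * e) *: Y + s *: Z).
  move=> s1; apply: (stein_psdmx sF'); rewrite trmxK.
  have -> : (2 * e) *: Y + s *: Z - F'^T *m ((2 * e) *: Y + s *: Z) *m F' =
      (2 * e) *: (Y - F'^T *m Y *m F') + s *: D.
    rewrite -res mulmxDr mulmxDl -!scalemxAr -!scalemxAl.
    by mxabel; ring.
  split=> [|x].
    by rewrite trmxD !trmxZ trmx_stein_residual // -res trmx_stein_residual.
  rewrite -[leRHS]/(qf _ x) qfDm !qfZm.
  have := Dle x; have := Ylb x; set a := qf _ x; set b := qf D x => aP bP.
  have : `|s * b| <= e * sqn x by rewrite normrM s1 mul1r.
  rewrite ler_norml => /andP[sb _].
  have : e * sqn x <= 2 * e * a.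
    rewrite (_ : e * sqn x = 2 * e * (2^-1 * sqn x)); last by field.
    by rewrite ler_wpM2l // mulr_ge0.
  by move: sb; lra.
have h1 : psdmx ((2 * e) *: Y - Z).
  by rewrite -scaleN1r; apply: squeeze; rewrite normrN1.
have h2 : psdmx ((2 * e) *: Y + Z).
  by rewrite -[Z]scale1r; apply: squeeze; rewrite normr1.
apply: le_trans (psdmx_squeeze i j h1 h2) _.
by rewrite linearZ /= !mulrA -natrM.
Qed.

End SteinPerturbation.

Section GramianContinuity.
Context {R : realType}.

Lemma eigenvalue_trmx (K : fieldType) n (M : 'M[K]_n) a :
  eigenvalue M^T a = eigenvalue M a.
Proof.
rewrite /eigenvalue /eigenspace !kermx_eq0 !row_free_unit.
by rewrite -{1}tr_scalar_mx -trmxN -trmxD unitmx_tr.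
Qed.

Lemma spectral_radius_trmx n (M : 'M[R]_n) :
  spectral_radius M^T = spectral_radius M.
Proof.
rewrite /spectral_radius -map_trmx; move: (map_mx _ M) => Mc.
have h z : eigenvalue Mc^T z = eigenvalue Mc z by exact: eigenvalue_trmx.
have e : [set z | eigenvalue Mc^T z] = [set z | eigenvalue Mc z].
  by apply/funext => z; rewrite /mkset h.
exact: (congr1 (fun E => sup [set Normc.normc z | z in E]) e).
Qed.

Context {n p : nat}.
Variables (A : 'M[R]_n) (C : 'M[R]_(p, n)).
Local Notation H := (C *m A).
Local Notation F := (closed_loop A C).
Local Notation S := (stable_gains A C).
Local Notation gramian := (gramian A C).

Lemma cvg_congr_closed_loop (X : 'M[R]_n) (L : 'M[R]_(n, p)) (e : R) : 0 < e ->
  \forall L' \near nbhs L,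
    mxl1 ((F L')^T *m X *m F L' - (F L)^T *m X *m F L) < e.
Proof.
move=> e0.
have Fc : F L' @[L' --> nbhs L] --> F L.
  by apply: cvg_closed_loop; exact: cvg_id.
have : mxl1 ((F L')^T *m X *m F L' - (F L)^T *m X *m F L) @[L' --> nbhs L] -->
    mxl1 ((F L)^T *m X *m F L - (F L)^T *m X *m F L).
  apply: cvg_mxl1; apply: cvgB; last exact: cvg_cst.
  apply: cvg_mulmx => //; apply: cvg_mulmx; last exact: cvg_cst.
  exact: cvg_trmx.
rewrite subrr [X in _ --> X](_ : _ = 0); last first.
  by rewrite /mxl1 big1 // => i _; rewrite big1 // => j _; rewrite mxE normr0.
by move=> /cvgr_lt; apply.
Qed.

(** The residual of [Y] is the identity at [L], hence at least 1/2 nearby. One fixed certificate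
    serves a whole neighbourhood, which gives both openness of the stabilising gains and a uniform
    constant in [stein_perturbation]. *)
Lemma local_lyapunov (L : 'M[R]_(n, p)) : S L ->
  exists2 Y : 'M[R]_n, psdmx Y & \forall L' \near nbhs L, S L' /\
    forall x, 2^-1 * sqn x <= qf (Y - (F L')^T *m Y *m F L') x.
Proof.
move=> LS; pose Y := dlyap (F L)^T 1%:M.
have sFT : stable (F L)^T by apply/stable_trmx/spectral_radius_stable.
have Yp : psdmx Y by apply: dlyap_psdmx (psdmx1 n).
have YE : Y = _ := dlyapE 1%:M sFT; rewrite -/Y trmxK in YE.
exists Y => //; near=> L'.
have dY : mxl1 ((F L')^T *m Y *m F L' - (F L)^T *m Y *m F L) < 2^-1.
  by near: L'; exact: cvg_congr_closed_loop.
have lb x : 2^-1 * sqn x <= qf (Y - (F L')^T *m Y *m F L') x.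
  have -> : Y - (F L')^T *m Y *m F L' =
      1%:M - ((F L')^T *m Y *m F L' - (F L)^T *m Y *m F L).
    by rewrite {1}YE opprB addrA; congr (_ - _); rewrite addrC.
  rewrite qfBm -/(sqn x); move: dY; set D := _ - _ => dY.
  have := le_trans (ler_norm _) (qf_le_mxl1 D x).
  have : mxl1 D * sqn x <= 2^-1 * sqn x by rewrite ler_wpM2r ?sqn_ge0 // ltW.
  by lra.
split; last exact: lb.
suff : spectral_radius (F L')^T < 1 by rewrite spectral_radius_trmx; apply.
apply: (lyapunov_spectral_radius Yp); rewrite trmxK; split=> [|x x0].
  exact/trmx_stein_residual/Yp.1.
by apply: lt_le_trans (lb x); rewrite mulr_gt0 ?sqn_gt0.
Unshelve. all: by end_near. Qed.

Lemma stable_gains_near (L : 'M[R]_(n, p)) : S L ->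
  \forall L' \near nbhs L, S L'.
Proof.
by move=> /local_lyapunov[Y _]; apply: filterS => L' [].
Qed.

Lemma cvg_gramian (L : 'M[R]_(n, p)) : S L ->
  gramian L' @[L' --> nbhs L] --> gramian L.
Proof.
move=> LS; have [Y Yp nearY] := local_lyapunov LS.
apply/cvg_mxP => i j; apply/cvgrPdist_le => e e0.
pose t := 4 * \tr Y + 1.
have t0 : 0 < t by rewrite ltr_wpDl // mulr_ge0 // psdmx_tr_ge0.
have et0 : 0 < e / t by rewrite divr_gt0.
near=> L'.
have [L'S Ylb] : S L' /\
    forall x, 2^-1 * sqn x <= qf (Y - (F L')^T *m Y *m F L') x.
  by near: L'.
have dW : mxl1 ((F L')^T *m gramian L *m F L' -
                (F L)^T *m gramian L *m F L) <= e / t.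
  by apply: ltW; near: L'; exact: cvg_congr_closed_loop.
have sF' : stable (F L')^T by apply/stable_trmx/stable_gain.
apply: le_trans (stein_perturbation i j sF' Yp (gramian_psd LS).1
  (gramian_psd L'S).1 (gramianE LS) (gramianE L'S) Ylb dW) _.
rewrite (_ : _ * \tr Y = 4 * \tr Y * e / t); last by ring.
by rewrite ler_pdivrMr // mulrC ler_pM2l // /t lerDl.
Unshelve. all: by end_near. Qed.

Variables (Q : 'M[R]_n) (V : 'M[R]_p).
Hypotheses (Qpd : pdmx Q) (Vpd : pdmx V).
Local Notation errcov := (errcov A C Q V).
Local Notation innov := (innov A C Q V).
Local Notation Kx := (Kx A C Q V).
Local Notation loss := (loss A C Q V).

Definition slope (L L' : 'M[R]_(n, p)) : 'M[R]_(n, p) :=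
  gramian L' *m (L' - L) *m innov (errcov L) - 2 *: (gramian L' *m Kx L).

Lemma loss_slope L : S L ->
  \forall L' \near nbhs L, loss L' - loss L = frob_dot (slope L L') (L' - L).
Proof.
move=> LS; near=> L'.
have L'S : S L' by near: L'; exact: stable_gains_near.
have := @loss_diff_gramian R n p A C Q V Qpd Vpd L (L' - L) LS.
by rewrite subrKC; apply.
Unshelve. all: by end_near. Qed.

Lemma cvg_slope L : S L ->
  slope L L' @[L' --> nbhs L] --> - 2 *: (gramian L *m Kx L).
Proof.
move=> LS; have Wc := cvg_gramian LS.
have -> : - 2 *: (gramian L *m Kx L) =
    gramian L *m (L - L) *m innov (errcov L) - 2 *: (gramian L *m Kx L).
  by rewrite subrr mulmx0 mul0mx sub0r scaleNr.
apply: cvgB.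
  apply: cvg_mulmx; last exact: cvg_cst.
  apply: cvg_mulmx => //; apply: cvgB; [exact: cvg_id|exact: cvg_cst].
by apply: cvgZr; apply: cvg_mulmx => //; exact: cvg_cst.
Qed.

End GramianContinuity.

(** * Gradient flows on a half-line *)

Section Flow.
Context {R : realType}.

Local Notation half t := (within `[0, +oo[ (t^')).

Lemma half_quotient_cvg (U : normedModType R) (u : R -> U) (l : U) (t : R) :
  (s - t)^-1 *: (u s - u t) @[s --> half t] --> l ->
  u s @[s --> half t] --> u t.
Proof.
move=> ul; have st : (s - t) @[s --> half t] --> (0 : R).
  rewrite -(subrr t); apply: cvgB; last exact: cvg_cst.
  by apply: cvg_within_filter; apply: cvg_within_filter; exact: cvg_id.
have : u t + (s - t) *: ((s - t)^-1 *: (u s - u t)) @[s --> half t] --> u t.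
  rewrite -[X in _ --> X]addr0 -[X in _ --> _ + X](scale0r l).
  by apply: cvgD; [exact: cvg_cst|exact: cvgZ].
apply: cvg_trans; apply: near_eq_cvg; near=> s.
rewrite scalerA divff ?scale1r ?subrKC // subr_eq0.
by near: s; apply: cvg_within; apply: withinT; exact: nbhs_filter.
Unshelve. all: by end_near. Qed.

Lemma half_is_derive (g : R -> R) (l t : R) : 0 < t ->
  (s - t)^-1 * (g s - g t) @[s --> half t] --> l -> is_derive t 1 g l.
Proof.
move=> t0 gl.
have sh : (h *: 1 + t) @[h --> (0 : R)^'] --> half t.
  move=> P /=; rewrite /within /= => hP.
  have {}hP : \forall s \near nbhs t, s != t -> P s.
    near=> s => st; have : `[0, +oo[%classic s.
      rewrite /= in_itv /= andbT; apply: ltW; near: s; exact: lt_nbhsr.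
    by move: st; near: s.
  have : (h *: 1 + t) @[h --> nbhs (0 : R)] --> t.
    rewrite -[X in _ --> X]add0r; apply: cvgD; last exact: cvg_cst.
    rewrite -[X in _ --> X](scale0r (1 : R)); apply: cvgZl; exact: cvg_id.
  move=> /(_ _ hP); rewrite /fmap /= /dnbhs /within /=.
  apply: (@filterS _ (nbhs (0 : R))) => h hh h0; apply: hh.
  by rewrite -subr_eq0 addrK scaler_eq0 oner_eq0 orbF.
have ql : (fun h : R => h^-1 *: ((g \o shift t) (h *: 1) - g t)) @ 0^' --> l.
  have := cvg_comp _ _ sh gl; apply: cvg_trans; apply: near_eq_cvg.
  near=> h; rewrite /= addrK.
  by rewrite /GRing.scale /= mulr1.
apply: DeriveDef; first by apply/cvg_ex; exists l.
by rewrite /derive; exact: cvg_lim ql.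
Unshelve. all: by end_near. Qed.

(** The product of [g] with the integrating factor [expR (a * s)] has non-positive derivative on the
    open half-line. At 0, where the quotient is one-sided, only right continuity is used. *)
Lemma half_gronwall (g g' : R -> R) (a : R) :
  (forall t : R, 0 <= t ->
    (s - t)^-1 * (g s - g t) @[s --> half t] --> g' t) ->
  (forall t : R, 0 <= t -> g' t <= - a * g t) ->
  forall t : R, 0 <= t -> g t <= expR (- a * t) * g 0.
Proof.
move=> gg' g'le t; rewrite le_eqVlt => /orP[/eqP <-|t0].
  by rewrite mulr0 expR0 mul1r.
pose phi s := expR (a * s) * g s.
have dphi (s : R) : 0 < s ->
    is_derive s 1 phi (expR (a * s) * (g' s + a * g s)).
  move=> s0; have ? : is_derive s 1 g (g' s).
    by apply: half_is_derive => //; apply: gg'; exact: ltW.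
  have ? : is_derive s 1 (expR \o (fun u : R => a * u)) (expR (a * s) * a).
    apply: is_derive1_comp.
    have := @is_deriveZ R R R id a s 1 1 (is_derive_id _ _).
    by rewrite /GRing.scale /= mulr1.
  apply: is_derive_eq; rewrite /GRing.scale /=; ring.
have : phi t <= phi 0.
  apply: (@ler0_derive1_le_cc _ phi 0 t) => //.
  - by move=> s; rewrite in_itv /= => /andP[/dphi[]].
  - move=> s; rewrite in_itv /= => /andP[s0 _]; have ? := dphi s s0.
    rewrite derive1E derive_val pmulr_rle0 ?expR_gt0 //.
    by rewrite -lerBrDr sub0r -mulNr; apply: g'le; exact: ltW.
  - apply/continuous_within_itvP => //; split.
    + move=> s; rewrite in_itv /= => /andP[/dphi[d _] _].
      by apply: differentiable_continuous; apply/derivable1_diffP.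
    + apply: cvgM.
        apply: cvg_at_right_filter; apply: continuous_comp => //.
          by apply: cvgZr.
        exact: continuous_expR.
      have := half_quotient_cvg (gg' 0 (lexx _)).
      apply: cvg_trans => P; rewrite /fmap /= /at_right /within /=.
      apply: (@filterS _ (nbhs (0 : R))) => s h s0.
      apply: h; first by rewrite gt_eqF.
      by rewrite in_itv /= andbT ltW.
    + have [d _] := dphi t t0; apply: cvg_at_left_filter.
      by apply: differentiable_continuous; apply/derivable1_diffP.
  - by rewrite in_itv /= lexx ltW.
  - by rewrite in_itv /= lexx ltW.
  - exact: ltW.
rewrite /phi mulr0 expR0 mul1r mulNr expRN => h.
by rewrite mulrC ler_pdivlMr ?expR_gt0 // mulrC.
Qed.

(** The chain rule obtained from the secant identity: the quotient of [f] along the curve is the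
    pairing of the slope with the quotient of [L], and both factors converge. *)
Lemma gradient_flow_quotient m n (S : set 'M[R]_(m, n)) (f : 'M[R]_(m, n) -> R)
    (L : R -> 'M[R]_(m, n)) (G : 'M[R]_(m, n) -> 'M[R]_(m, n) -> 'M[R]_(m, n))
    (g : 'M[R]_(m, n) -> 'M[R]_(m, n)) :
  (forall X, S X ->
    (\forall Y \near nbhs X, f Y - f X = frob_dot (G X Y) (Y - X)) /\
    G X Y @[Y --> nbhs X] --> g X) ->
  gradient_flow S f L -> forall t, 0 <= t ->
  (s - t)^-1 * (f (L s) - f (L t)) @[s --> half t] -->
    - frob_dot (g (L t)) (g (L t)).
Proof.
move=> fG fl t t0; have [LS Ld] := fl t t0.
have [fN Gg] := fG _ LS.
have := is_gradientE (slope_is_gradient fN Gg) => gE; rewrite gE in Ld.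
have Lc : L s @[s --> half t] --> L t by exact: half_quotient_cvg Ld.
have : frob_dot (G (L t) (L s)) ((s - t)^-1 *: (L s - L t)) @[s --> half t] -->
    frob_dot (g (L t)) (- g (L t)).
  by apply: cvg_frob_dot Ld; exact: cvg_comp Lc Gg.
rewrite [X in _ --> X -> _](_ : _ = - frob_dot (g (L t)) (g (L t))); last first.
  by rewrite /frob_dot mulmxN linearN.
apply: cvg_trans; apply: near_eq_cvg.
have := Lc _ fN; apply: (@filterS _ (half t)) => s /= ->.
by rewrite /frob_dot -scalemxAr linearZ.
Qed.

End Flow.

(** * Second moments and independence *)

Section Independence.
Context d (Omega : measurableType d) (R : realType) (P : probability Omega R).

(* The law of the pair is the product of the laws, so Fubini applies. *)
Lemma indep_integral_mul_eq0 (X Y : {RV P >-> R}) :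
  (forall B B' : set R, measurable B -> measurable B' ->
     P (X @^-1` B `&` Y @^-1` B') = (P (X @^-1` B) * P (Y @^-1` B'))%E) ->
  P.-integrable setT (fun o => (X o * Y o)%:E) ->
  P.-integrable setT (fun o => (Y o)%:E) ->
  (\int[P]_o (Y o)%:E = 0)%E -> (\int[P]_o (X o * Y o)%:E = 0)%E.
Proof.
move=> XYind XYint Yint Y0.
pose XY o : R * R := (X o, Y o).
have mXY : measurable_fun setT XY by apply: measurable_fun_pair.
pose XYm : {mfun Omega >-> (R * R)%type} :=
  HB.pack XY (isMeasurableFun.Build _ _ _ _ XY mXY).
pose f (z : R * R) : \bar R := (z.1 * z.2)%:E.
have mf : measurable_fun [set: R * R] f.
  by apply/measurable_EFinP; apply: measurable_funM.
have prodE (A : set (R * R)) : measurable A ->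
    (distribution P X \x distribution P Y)%E A = distribution P XYm A.
  apply: product_measure_unique => B B' mB mB'.
  by rewrite /distribution /pushforward -XYind.
have fint : (distribution P XYm).-integrable setT f.
  by apply: integrable_pushforward.
have fint' : (distribution P X \x distribution P Y)%E.-integrable setT f.
  apply/integrableP; split=> //; case/integrableP: fint => _; apply: le_lt_trans.
  by rewrite (eq_measure_integral (distribution P XYm)) // => A mA _; exact: prodE.
transitivity (\int[distribution P XYm]_z f z)%E.
  by rewrite integral_pushforward.
rewrite -(eq_measure_integral _ (fun A mA _ => prodE A mA)).
rewrite -integral12_prod_meas1 // integral0_eq // => x _.
transitivity (x%:E * \int[distribution P Y]_y (y%:E))%E.
  rewrite -integralZl //; exact: integrable_pushforward.
rewrite (_ : (\int[distribution P Y]_y y%:E)%E = 0%E) ?mule0 //.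
by rewrite -{}[RHS]Y0 integral_pushforward.
Qed.

Lemma Rintegral_sum (I : finType) (f : I -> Omega -> R) :
  (forall i, P.-integrable setT (EFin \o f i)) ->
  (\int[P]_o (\sum_i f i o) = \sum_i \int[P]_o f i o)%R.
Proof.
move=> fi; have : forall s : seq I,
    P.-integrable setT (EFin \o (fun o => \sum_(i <- s) f i o)) /\
    (\int[P]_o (\sum_(i <- s) f i o) = \sum_(i <- s) \int[P]_o f i o)%R.
  elim=> [|i s [IHi IH]].
    split.
      by under eq_fun do rewrite big_nil; exact: finite_measure_integrable_cst.
    under eq_Rintegral do rewrite big_nil.
    by rewrite big_nil Rintegral_cst // mul0r.
  split.
    rewrite (_ : EFin \o _ = (EFin \o f i) \+
      (EFin \o (fun o => (\sum_(i <- s) f i o)%R)))%E; first exact: integrableD.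
    by apply/funext => o /=; rewrite big_cons EFinD.
  rewrite big_cons -IH -RintegralD //.
  by apply: eq_Rintegral => o _; rewrite big_cons.
by move=> /(_ (index_enum _))[].
Qed.

Definition sqint (X : Omega -> R) : Prop :=
  measurable_fun setT X /\ P.-integrable setT (fun o => (X o ^+ 2)%:E).

Lemma sqint_mul X Y : sqint X -> sqint Y ->
  P.-integrable setT (fun o => (X o * Y o)%:E).
Proof.
move=> [mX iX] [mY iY].
apply: (@le_integrable _ _ _ _ _ _ _ 
  (fun o => (X o ^+ 2)%:E + (Y o ^+ 2)%:E)%E) => //.
- by apply/measurable_EFinP; exact: measurable_funM.
- move=> o _; rewrite -EFinD !abse_EFin lee_fin normrM.
  rewrite (ger0_norm (addr_ge0 (sqr_ge0 _) (sqr_ge0 _))).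
  rewrite -(real_normK (num_real (X o))) -(real_normK (num_real (Y o))).
  by have := sqr_ge0 (`|X o| - `|Y o|); nra.
- exact: integrableD.
Qed.

Lemma sqint_cst c : sqint (fun=> c).
Proof.
by split=> //; exact: finite_measure_integrable_cst.
Qed.

Lemma sqint_integrable X : sqint X -> P.-integrable setT (fun o => (X o)%:E).
Proof.
move=> Xs; have := sqint_mul Xs (sqint_cst 1).
by under eq_fun do rewrite mulr1.
Qed.

Lemma sqintD X Y : sqint X -> sqint Y -> sqint (fun o => X o + Y o).
Proof.
move=> Xs Ys; have [[mX iX] [mY iY]] := (Xs, Ys).
split; first exact: measurable_funD.
have iXY := sqint_mul Xs Ys.
rewrite (_ : (fun o => ((X o + Y o) ^+ 2)%:E) =
  (fun o => ((X o ^+ 2)%:E + (Y o ^+ 2)%:E) + (2%:E * (X o * Y o)%:E))%E).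
  by apply: integrableD => //; [exact: integrableD|exact: integrableZl].
by apply/funext => o; rewrite -EFinM -!EFinD; congr EFin; ring.
Qed.

Lemma sqintZ a X : sqint X -> sqint (fun o => a * X o).
Proof.
move=> [mX iX]; split; first exact: measurable_funM.
rewrite (_ : (fun o => ((a * X o) ^+ 2)%:E) =
  (fun o => (a ^+ 2)%:E * (X o ^+ 2)%:E)%E); first exact: integrableZl.
by apply/funext => o; rewrite exprMn EFinM.
Qed.

Lemma sqint_sum (I : finType) (X : I -> Omega -> R) :
  (forall i, sqint (X i)) -> sqint (fun o => \sum_i X i o).
Proof.
move=> Xs; have h (s : seq I) : sqint (fun o => \sum_(i <- s) X i o).
  elim: s => [|i s IH].
    by under eq_fun do rewrite big_nil; exact: sqint_cst.
  by under eq_fun do rewrite big_cons; exact: sqintD.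
exact: h.
Qed.

End Independence.

(** * Cross-covariances of square-integrable random vectors *)

Section CrossCovariance.
Context d (Omega : measurableType d) (R : realType) (P : probability Omega R).
Local Notation sqint := (sqint P).

Definition sqv m (X : Omega -> 'cV[R]_m) : Prop :=
  forall i, sqint (fun o => X o i 0).

(** Not centred: the initial error may have a non-zero mean, and the limits in question are those of
    raw second moments. *)
Definition ccov m k (X : Omega -> 'cV[R]_m) (Y : Omega -> 'cV[R]_k) :
    'M[R]_(m, k) :=
  mx_expectation P (fun o => X o *m (Y o)^T).

Lemma ccovE m k (X : Omega -> 'cV[R]_m) (Y : Omega -> 'cV[R]_k) i j :
  ccov X Y i j = (\int[P]_o (X o i 0 * Y o j 0))%R.
Proof.
rewrite mxE unlock /Rintegral; congr fine.
by apply: eq_integral => o _; rewrite !mxE big_ord1 mxE.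
Qed.

Lemma ccov_trmx m k (X : Omega -> 'cV[R]_m) (Y : Omega -> 'cV[R]_k) :
  (ccov X Y)^T = ccov Y X.
Proof.
apply/matrixP => i j; rewrite [LHS]mxE !ccovE; apply: eq_Rintegral => o _.
by rewrite mulrC.
Qed.

Lemma sqvD m (X Y : Omega -> 'cV[R]_m) :
  sqv X -> sqv Y -> sqv (fun o => X o + Y o).
Proof.
by move=> Xs Ys i; under eq_fun do rewrite mxE; exact: sqintD.
Qed.

Lemma sqvM m k (B : 'M[R]_(k, m)) (X : Omega -> 'cV[R]_m) :
  sqv X -> sqv (fun o => B *m X o).
Proof.
move=> Xs i; under eq_fun do rewrite mxE.
by apply: sqint_sum => j; exact: sqintZ.
Qed.

Lemma ccovDl m k (X X' : Omega -> 'cV[R]_m) (Y : Omega -> 'cV[R]_k) :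
  sqv X -> sqv X' -> sqv Y ->
  ccov (fun o => X o + X' o) Y = ccov X Y + ccov X' Y.
Proof.
move=> Xs X's Ys; apply/matrixP => i j; rewrite [RHS]mxE !ccovE.
rewrite -RintegralD //; [|exact: sqint_mul|exact: sqint_mul].
by apply: eq_Rintegral => o _; rewrite mxE mulrDl.
Qed.

Lemma ccovMl m l k (B : 'M[R]_(l, m)) (X : Omega -> 'cV[R]_m)
    (Y : Omega -> 'cV[R]_k) : sqv X -> sqv Y ->
  ccov (fun o => B *m X o) Y = B *m ccov X Y.
Proof.
move=> Xs Ys; apply/matrixP => i j; rewrite ccovE [RHS]mxE.
have e h : B i h * ccov X Y h j = (\int[P]_o (B i h * (X o h 0 * Y o j 0)))%R.
  by rewrite ccovE RintegralZl //; exact: sqint_mul.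
rewrite (eq_bigr _ (fun h _ => e h)).
transitivity (\int[P]_o (\sum_h B i h * (X o h 0 * Y o j 0)))%R.
  apply: eq_Rintegral => o _; rewrite mxE big_distrl /=.
  by apply: eq_bigr => h _; rewrite mulrA.
rewrite Rintegral_sum // => h; have := sqint_mul (sqintZ (B i h) (Xs h)) (Ys j).
by under eq_fun do rewrite -mulrA.
Qed.

Lemma ccovDr m k (X : Omega -> 'cV[R]_m) (Y Y' : Omega -> 'cV[R]_k) :
  sqv X -> sqv Y -> sqv Y' ->
  ccov X (fun o => Y o + Y' o) = ccov X Y + ccov X Y'.
Proof.
by move=> *; rewrite -ccov_trmx ccovDl // trmxD !ccov_trmx.
Qed.

Lemma ccovMr m l k (B : 'M[R]_(l, k)) (X : Omega -> 'cV[R]_m)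
    (Y : Omega -> 'cV[R]_k) : sqv X -> sqv Y ->
  ccov X (fun o => B *m Y o) = ccov X Y *m B^T.
Proof.
by move=> *; rewrite -ccov_trmx ccovMl // trmx_mul ccov_trmx.
Qed.

Lemma borel_coord m i (B : set R) : measurable B ->
  @borel R m [set x | B (x i 0)].
Proof.
move=> mB.
have : measurable_fun setT ((fun x => x i 0) :
    g_sigma_algebraType [set U : set 'cV[R]_m | open U] -> R).
  apply: (measurability _ (RGenOpens.measurableE R)).
  move=> _ [_ [a [b ->] <-]]; rewrite setTI; apply: sub_sigma_algebra => /=.
  have /continuousP := @coord_continuous R m 1 i 0; apply.
  exact: interval_open.
by move=> /(_ measurableT B mB); rewrite setTI.
Qed.

Lemma random_vector_coord m (X : Omega -> 'cV[R]_m) i :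
  random_vector X -> measurable_fun setT (fun o => X o i 0).
Proof.
move=> mX _ B mB; rewrite setTI.
exact: (mX _ (borel_coord i mB)).
Qed.

Lemma random_vector_sqv m (X : Omega -> 'cV[R]_m) :
  random_vector X -> finite_second_moment P X -> sqv X.
Proof.
by move=> mX iX i; split; [exact: random_vector_coord|exact: iX].
Qed.

Lemma indep_ccov m k (X : Omega -> 'cV[R]_m) (Y : Omega -> 'cV[R]_k) :
  sqv X -> sqv Y -> sigma_indep P (sigma_vec X) (sigma_vec Y) ->
  mx_expectation P Y = 0 -> ccov X Y = 0.
Proof.
move=> Xs Ys ind Y0; apply/matrixP => i j; rewrite ccovE mxE.
have [mX _] := Xs i; have [mY _] := Ys j.
pose Xm : {mfun Omega >-> R} := HB.pack (fun o => X o i 0)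
  (isMeasurableFun.Build _ _ _ _ (fun o => X o i 0) mX).
pose Ym : {mfun Omega >-> R} := HB.pack (fun o => Y o j 0)
  (isMeasurableFun.Build _ _ _ _ (fun o => Y o j 0) mY).
rewrite /Rintegral; have /= -> // := @indep_integral_mul_eq0 _ _ _ P Xm Ym.
- move=> B B' mB mB'; apply: ind.
    by exists [set x | B (x i 0)] => //; exact: borel_coord.
  by exists [set x | B' (x j 0)] => //; exact: borel_coord.
- exact: sqint_mul.
- exact: sqint_integrable.
- have := congr1 (fun M : 'cV[R]_k => M j 0) Y0; rewrite !mxE unlock /= => Y0j.
  rewrite -[LHS]fineK ?Y0j //; apply: integrable_fin_num => //.
  exact: sqint_integrable.
Qed.

End CrossCovariance.

(** * Covariances along the filter *)

Section FilterCovariance.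
Context d (Omega : measurableType d) (R : realType) (P : probability Omega R).
Context (n p : nat) (A : 'M[R]_n) (C : 'M[R]_(p, n)) (Q : 'M[R]_n) (V : 'M[R]_p).
Context (w : nat -> Omega -> 'cV[R]_n) (v : nat -> Omega -> 'cV[R]_p).
Context (x0 xhat0 : Omega -> 'cV[R]_n).
Hypotheses (Qpd : pdmx Q) (Vpd : pdmx V).
Hypotheses (w_noise : iid_noise P w Q) (v_noise : iid_noise P v V).
Hypothesis wv_indep : sigma_indep P (sigma_seq w) (sigma_seq v).
Hypothesis init : initial_data P x0 xhat0.
Hypothesis init_indep : indep_of_noises P x0 xhat0 w v.

Local Notation sqv := (sqv P).
Local Notation ccov := (ccov P).
Local Notation H := (C *m A).
Local Notation F := (closed_loop A C).
Local Notation error := (error A C w v x0 xhat0).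
Local Notation innovation := (innovation A C w v x0 xhat0).

Lemma sigma_indepW (E E' G G' : set (set Omega)) :
  sigma_indep P G G' -> E `<=` G -> E' `<=` G' -> sigma_indep P E E'.
Proof. by move=> ind EG EG' X Y /EG GX /EG' GY; exact: ind. Qed.

Lemma sigma_vec_seq m (X : nat -> Omega -> 'cV[R]_m) t :
  sigma_vec (X t) `<=` sigma_seq X.
Proof. by move=> B XB; apply: sub_sigma_algebra; exists t. Qed.

Lemma noise_sqv m (X : nat -> Omega -> 'cV[R]_m) M t : iid_noise P X M -> sqv (X t).
Proof.
move=> Xn; apply: random_vector_sqv.
  exact: (noise_measurable Xn).
exact: (noise_second_moment Xn).
Qed.

Lemma noise_ccov_neq m (X : nat -> Omega -> 'cV[R]_m) M s t : iid_noise P X M ->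
  s != t -> ccov (X s) (X t) = 0.
Proof.
move=> Xn st; apply: indep_ccov.
- exact: (noise_sqv s Xn).
- exact: (noise_sqv t Xn).
- move=> E E' sE tE'.
  have := noise_indep Xn (s := [:: s; t]) (E := fun i => if i == s then E else E').
  rewrite !big_cons !big_nil /= eqxx eq_sym (negbTE st) setIT mule1; apply.
    by rewrite /= inE st.
  move=> i; rewrite !inE => /orP[/eqP ->|/eqP ->]; first by rewrite eqxx.
  by rewrite eq_sym (negbTE st).
- exact: (noise_zero_mean Xn).
Qed.

Lemma ccov_wv s t : ccov (w s) (v t) = 0.
Proof.
apply: indep_ccov (noise_zero_mean v_noise t).
- exact: (noise_sqv s w_noise).
- exact: (noise_sqv t v_noise).
- by apply: sigma_indepW wv_indep _ _; exact: sigma_vec_seq.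
Qed.

Lemma init_sqv : sqv x0 /\ sqv xhat0.
Proof. by case: init => *; split; exact: random_vector_sqv. Qed.

Lemma init_ccov x : x = x0 \/ x = xhat0 ->
  (forall t, ccov x (w t) = 0) /\ (forall t, ccov x (v t) = 0).
Proof.
move=> xE; have xs : sqv x by case: xE => ->; have [] := init_sqv.
have xind : sigma_vec x `<=` <<s sigma_vec x0 `|` sigma_vec xhat0 >>.
  by move=> B xB; apply: sub_sigma_algebra; case: xE xB => ->; [left|right].
split=> t.
  apply: indep_ccov (noise_zero_mean w_noise t) => //.
    exact: (noise_sqv t w_noise).
  apply: sigma_indepW init_indep xind _ => B wB.
  by apply: sub_sigma_algebra; left; exact: sigma_vec_seq wB.
apply: indep_ccov (noise_zero_mean v_noise t) => //.
  exact: (noise_sqv t v_noise).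
apply: sigma_indepW init_indep xind _ => B vB.
by apply: sub_sigma_algebra; right; exact: sigma_vec_seq vB.
Qed.

Variable L : 'M[R]_(n, p).

Lemma innovationE t : innovation L t =
  (fun o => H *m error L t o + (C *m w t o + v t.+1 o)).
Proof.
apply/funext => o; rewrite /innovation /output /error /=.
move: (state _ _ _ _ _) (estimate _ _ _ _ _ _ _ _ _) => x xh.
mxexpand; mxabel; ring.
Qed.

(** Separating the correction [- L delta] from the prediction error is what produces [cross]; the
    closed-loop form [errorE] serves the covariance recursion. *)
Lemma error_innovationE t : error L t.+1 =
  (fun o => (A *m error L t o + w t o) + (- L) *m innovation L t o).
Proof.
apply/funext => o; rewrite /innovation /error /= /output /=.
move: (state _ _ _ _ _) (estimate _ _ _ _ _ _ _ _ _) => x xh.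
mxexpand; mxabel; ring.
Qed.

Lemma errorE t : error L t.+1 =
  (fun o => F L *m error L t o + ((1%:M - L *m C) *m w t o + (- L) *m v t.+1 o)).
Proof.
rewrite error_innovationE innovationE; apply/funext => o; rewrite closed_loopE.
move: (error _ _ _) => e; mxexpand; rewrite ?mul1mx.
mxabel; ring.
Qed.

Lemma error_sqv t : sqv (error L t).
Proof.
elim: t => [|t IH].
  have [x0s xhs] := init_sqv.
  rewrite (_ : error L 0 = (fun o => x0 o + (- 1%:M) *m xhat0 o)).
    by apply: sqvD => //; exact: sqvM.
  by apply/funext => o; rewrite mulNmx mul1mx.
rewrite errorE; apply: sqvD; first exact: sqvM.
apply: sqvD; apply: sqvM; [exact: (noise_sqv t w_noise)|].
exact: (noise_sqv t.+1 v_noise).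
Qed.

(** The error at time [t] involves [w] strictly before [t] and [v] up to [t]. Orthogonality to later
    noise, rather than independence from it, is carried along because a linear recursion preserves
    it term by term and second moments ask for nothing more. *)
Lemma ccov_error_noise t :
  (forall s, (t <= s)%N -> ccov (error L t) (w s) = 0) /\
  (forall s, (t < s)%N -> ccov (error L t) (v s) = 0).
Proof.
have ws s := noise_sqv s w_noise; have vs s := noise_sqv s v_noise.
elim: t => [|t [IHw IHv]].
  have [x0s xhs] := init_sqv.
  have [x0w x0v] := init_ccov (or_introl erefl).
  have [xhw xhv] := init_ccov (or_intror erefl).
  have -> : error L 0 = (fun o => x0 o + (- 1%:M) *m xhat0 o).
    by apply/funext => o; rewrite mulNmx mul1mx.
  by split=> s _; rewrite ccovDl ?ccovMl ?x0w ?x0v ?xhw ?xhv ?mulmx0 ?addr0 //;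
    exact: sqvM.
have es := error_sqv t.
have Fes : sqv (fun o => F L *m error L t o) by exact: sqvM.
have Gws : sqv (fun o => (1%:M - L *m C) *m w t o) by exact: sqvM.
have Lvs : sqv (fun o => (- L) *m v t.+1 o) by exact: sqvM.
have GLs : sqv (fun o => (1%:M - L *m C) *m w t o + (- L) *m v t.+1 o).
  exact: sqvD.
rewrite errorE; split=> s ts; rewrite !ccovDl // !ccovMl //.
  rewrite IHw ?(ltnW ts) // (noise_ccov_neq w_noise) ?ltn_eqF //.
  by rewrite -(ccov_trmx _ (w s)) ccov_wv trmx0 !mulmx0 !addr0.
rewrite IHv ?(ltn_trans _ ts) // ccov_wv (noise_ccov_neq v_noise) ?ltn_eqF //.
by rewrite !mulmx0 !addr0.
Qed.

Definition error_cov t : 'M[R]_n := ccov (error L t) (error L t).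

Lemma noise_ccov m (X : nat -> Omega -> 'cV[R]_m) M t : iid_noise P X M ->
  ccov (X t) (X t) = M.
Proof. by move=> Xn; exact: (noise_covariance Xn). Qed.

Lemma innovation_sqv t : sqv (innovation L t).
Proof.
rewrite innovationE; apply: sqvD; first by apply: sqvM; exact: error_sqv.
apply: sqvD; last exact: (noise_sqv _ v_noise).
by apply: sqvM; exact: (noise_sqv _ w_noise).
Qed.

Lemma error_cov_step t : error_cov t.+1 = riccati A C Q V L (error_cov t).
Proof.
have ws := noise_sqv t w_noise; have vs := noise_sqv t.+1 v_noise.
have es := error_sqv t.
have [ew ev] := ccov_error_noise t.
have {}ew := ew t (leqnn t); have {}ev := ev t.+1 (ltnSn t).
have we : ccov (w t) (error L t) = 0 by rewrite -ccov_trmx ew trmx0.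
have ve : ccov (v t.+1) (error L t) = 0 by rewrite -ccov_trmx ev trmx0.
have wv := ccov_wv t t.+1.
have vw : ccov (v t.+1) (w t) = 0 by rewrite -ccov_trmx wv trmx0.
have Fes : sqv (fun o => F L *m error L t o) by exact: sqvM.
have Gws : sqv (fun o => (1%:M - L *m C) *m w t o) by exact: sqvM.
have Lvs : sqv (fun o => (- L) *m v t.+1 o) by exact: sqvM.
have GLs : sqv (fun o => (1%:M - L *m C) *m w t o + (- L) *m v t.+1 o).
  exact: sqvD.
have FGLs := sqvD Fes GLs.
rewrite /error_cov errorE; set Sg := ccov (error L t) (error L t).
rewrite !ccovDl // !ccovDr // !ccovMl // !ccovMr //.
rewrite ew ev we ve wv vw (noise_ccov t w_noise) (noise_ccov t.+1 v_noise).
rewrite !(mulmx0, mul0mx, addr0, add0r) /riccati /noise_in !mulmxA.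
by rewrite trmxN mulmxN !mulNmx opprK.
Qed.

Lemma ccov_innovation t :
  ccov (innovation L t) (innovation L t) = innov A C Q V (error_cov t).
Proof.
have ws := noise_sqv t w_noise; have vs := noise_sqv t.+1 v_noise.
have es := error_sqv t.
have [ew ev] := ccov_error_noise t.
have {}ew := ew t (leqnn t); have {}ev := ev t.+1 (ltnSn t).
have we : ccov (w t) (error L t) = 0 by rewrite -ccov_trmx ew trmx0.
have ve : ccov (v t.+1) (error L t) = 0 by rewrite -ccov_trmx ev trmx0.
have wv := ccov_wv t t.+1.
have vw : ccov (v t.+1) (w t) = 0 by rewrite -ccov_trmx wv trmx0.
have Hes : sqv (fun o => H *m error L t o) by exact: sqvM.
have Cws : sqv (fun o => C *m w t o) by exact: sqvM.
have Cwvs : sqv (fun o => C *m w t o + v t.+1 o) by exact: sqvD.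
have HCs := sqvD Hes Cwvs.
rewrite innovationE !ccovDl // !ccovDr // !ccovMl // !ccovMr //.
rewrite ew ev we ve wv vw (noise_ccov t w_noise) (noise_ccov t.+1 v_noise).
rewrite !(mulmx0, mul0mx, addr0, add0r) /innov /prior_cov -/(error_cov t).
by rewrite mulmxDr mulmxDl trmx_mul !mulmxA addrA.
Qed.

Lemma ccov_error_innovation t :
  ccov (error L t.+1) (innovation L t) = cross A C Q V L (error_cov t).
Proof.
have ws := noise_sqv t w_noise; have vs := noise_sqv t.+1 v_noise.
have es := error_sqv t; have its := innovation_sqv t.
have [ew ev] := ccov_error_noise t.
have {}ew := ew t (leqnn t); have {}ev := ev t.+1 (ltnSn t).
have we : ccov (w t) (error L t) = 0 by rewrite -ccov_trmx ew trmx0.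
have wv := ccov_wv t t.+1.
have Aes : sqv (fun o => A *m error L t o) by exact: sqvM.
have Awes := sqvD Aes ws.
have Lis : sqv (fun o => (- L) *m innovation L t o) by exact: sqvM.
have Hes : sqv (fun o => H *m error L t o) by exact: sqvM.
have Cws : sqv (fun o => C *m w t o) by exact: sqvM.
have Cwvs : sqv (fun o => C *m w t o + v t.+1 o) by exact: sqvD.
rewrite error_innovationE !ccovDl // !ccovMl // ccov_innovation mulNmx.
have -> : ccov (error L t) (innovation L t) = error_cov t *m H^T.
  by rewrite innovationE !ccovDr // !ccovMr // ew ev mul0mx !addr0.
have -> : ccov (w t) (innovation L t) = Q *m C^T.
  rewrite innovationE !ccovDr // !ccovMr // we wv (noise_ccov t w_noise).
  by rewrite mul0mx add0r addr0.
by rewrite /cross /prior_cov mulmxDl trmx_mul !mulmxA.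
Qed.

Hypothesis LS : stable_gains A C L.
Local Notation Ps := (errcov A C Q V L).

Lemma cvg_error_cov : error_cov t @[t --> \oo] --> Ps.
Proof.
have sF := stable_gain LS.
(* Subtracting the fixed point cancels the noise, so the deviation evolves homogeneously. *)
have E t : error_cov t = (F L) ^+ t *m (error_cov 0 - Ps) *m ((F L) ^+ t)^T + Ps.
  elim: t => [|t IH].
    by rewrite expr0 -[1]/(1%:M) trmx1 mul1mx mulmx1 subrK.
  rewrite error_cov_step {}IH; move: (error_cov 0 - Ps) => D0.
  rewrite [in RHS]errcovE // /riccati mulmxDr mulmxDl.
  by rewrite -addrA exprS -[F L * _]/(F L *m _) (trmx_mul (F L) (_ ^+ t)) !mulmxA.
have : ((F L) ^+ t *m (error_cov 0 - Ps) *m ((F L) ^+ t)^T + Ps) @[t --> \oo]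
    --> (0 : 'M[R]_n) + Ps.
  by apply: cvgD; [exact: cvg_congr_pow|exact: cvg_cst].
rewrite add0r; apply: cvg_trans; apply: near_eq_cvg; near=> t.
by rewrite -E.
Unshelve. all: by end_near. Qed.

Lemma cvg_innov : innov A C Q V (error_cov t) @[t --> \oo] --> innov A C Q V Ps.
Proof.
have c := cvg_error_cov.
apply: cvgD; last exact: cvg_cst.
apply: cvg_mulmx; last exact: cvg_cst.
apply: cvg_mulmx; first exact: cvg_cst.
apply: cvgD; last exact: cvg_cst.
apply: cvg_mulmx; last exact: cvg_cst.
by apply: cvg_mulmx => //; exact: cvg_cst.
Qed.

Lemma innovation_covE :
  innovation_cov P A C w v x0 xhat0 L = innov A C Q V Ps.
Proof.
apply: cvg_lim; first exact: norm_hausdorff.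
have := cvg_innov; apply: cvg_trans; apply: near_eq_cvg; near=> t.
by rewrite -ccov_innovation.
Unshelve. all: by end_near. Qed.

Lemma innovation_lossE :
  innovation_loss P A C w v x0 xhat0 L = loss A C Q V L.
Proof. by rewrite /innovation_loss innovation_covE. Qed.

Lemma cross_covE : cross_cov P A C w v x0 xhat0 L = Kx A C Q V L.
Proof.
apply: cvg_lim; first exact: norm_hausdorff.
have c := cvg_error_cov; have ci := cvg_innov.
have : cross A C Q V L (error_cov t) @[t --> \oo] --> Kx A C Q V L.
  apply: cvgB; last by apply: cvg_mulmx => //; exact: cvg_cst.
  apply: cvg_mulmx; last exact: cvg_cst.
  apply: cvgD; last exact: cvg_cst.
  apply: cvg_mulmx; last exact: cvg_cst.
  by apply: cvg_mulmx => //; exact: cvg_cst.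
apply: cvg_trans; apply: near_eq_cvg; near=> t.
by rewrite -ccov_error_innovation.
Unshelve. all: by end_near. Qed.

Lemma steady_mseE : steady_mse P A C w v x0 xhat0 L = \tr Ps.
Proof.
apply: cvg_lim; first exact: Rhausdorff.
have : \tr (error_cov t) @[t --> \oo] --> \tr Ps.
  by apply: cvg_mxtrace; exact: cvg_error_cov.
apply: cvg_trans; apply: near_eq_cvg; near=> t.
rewrite unlock -/(Rintegral P setT _) Rintegral_sum; last first.
  by move=> i; have [] := error_sqv t i.
by apply: eq_bigr => i _; rewrite /error_cov ccovE.
Unshelve. all: by end_near. Qed.

End FilterCovariance.

(** * Convergence of the flow *)

Lemma tr_congrB (R : comNzRingType) n p (H : 'M[R]_(p, n)) (X Y : 'M[R]_n) :
  \tr (H *m X *m H^T) - \tr (H *m Y *m H^T) = \tr (H^T *m H *m (X - Y)).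
Proof.
by rewrite mulmxBr raddfB /= !(mxtrace_mulC _ H^T) !mulmxA.
Qed.

Section FlowConvergence.
Context {R : realType} {n p : nat}.
Variables (A : 'M[R]_n) (C : 'M[R]_(p, n)) (Q : 'M[R]_n) (V : 'M[R]_p).
Hypotheses (Qpd : pdmx Q) (Vpd : pdmx V).
Hypothesis obs : observable A (C *m A).
Local Notation S := (stable_gains A C).
Local Notation gramian := (gramian A C).
Local Notation errcov := (errcov A C Q V).
Local Notation Kx := (Kx A C Q V).
Local Notation loss := (loss A C Q V).

Lemma sublevel_gramian_lower L0 : S L0 -> exists2 k : R, 0 < k &
  forall L, S L -> loss L <= loss L0 -> forall x, k * sqn x <= qf (gramian L) x.
Proof.
move=> L0S; have [b b0 bP] := riccati_fixpoint_bounded Qpd Vpd obs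
  (\tr (C *m A *m errcov L0 *m (C *m A)^T)).
have [k k0 kP] := gramian_lower obs b.
exists k => // L LS LL0; apply: kP => //.
suff h : \tr (C *m A *m errcov L *m (C *m A)^T) <=
    \tr (C *m A *m errcov L0 *m (C *m A)^T).
  by have [] := bP L _ (errcov_psd Qpd Vpd LS) (errcovE Q V LS) h.
by rewrite -subr_le0 tr_congrB -loss_diff subr_le0.
Qed.

Lemma stationary_min L0 L : S L0 -> Kx L0 = 0 -> S L -> loss L0 <= loss L.
Proof.
move=> L0S K0 LS; have [r r0 Vr] := pdmx_lower Vpd.
have [h _] := loss_lower Qpd Vpd r0 Vr L0S K0 LS.
rewrite -subr_ge0; apply: le_trans h; apply: mulr_ge0; first exact: ltW.
exact/psdmx_tr_ge0/psdmx_congrT/gramian_psd.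
Qed.

Lemma errcov_tr_minimiser L0 L : S L0 -> Kx L0 = 0 -> S L ->
  \tr (errcov L0) <= \tr (errcov L) /\
  (\tr (errcov L) <= \tr (errcov L0) -> L = L0).
Proof.
move=> L0S K0 LS; have [r r0 Vr] := pdmx_lower Vpd.
have [_ h] := loss_lower Qpd Vpd r0 Vr L0S K0 LS; split=> [|h'].
  rewrite -subr_ge0; apply: le_trans h; apply: mulr_ge0; first exact: ltW.
  exact: frob_dot_ge0.
apply/eqP; rewrite -subr_eq0; apply/eqP/frob_dot_eq0/eqP.
rewrite eq_le frob_dot_ge0 andbT -(ler_pM2l r0) mulr0.
by apply: le_trans h _; rewrite subr_le0.
Qed.

(** Each of two stationary gains minimises [tr P]. Hence [K] vanishes at no other stabilising gain,
    and the denominators in [gap_ratio] are positive. *)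
Lemma stationary_unique L0 L : S L0 -> Kx L0 = 0 -> S L -> Kx L = 0 -> L = L0.
Proof.
move=> L0S K0 LS K; have [_] := errcov_tr_minimiser L0S K0 LS; apply.
by have [] := errcov_tr_minimiser LS K L0S.
Qed.

(** In [gradient_dominance] the Gramian is the one of the reference gain, so freezing that gain at
    [L0] makes the constant independent of [L]. *)
Lemma loss_gap_le L0 : S L0 -> exists2 c : R, 0 < c &
  forall L, S L -> loss L - loss L0 <= c * frob_dot (Kx L) (Kx L).
Proof.
move=> L0S; have [r r0 Vr] := pdmx_lower Vpd.
pose g := mxl1 (gramian L0) + 1.
have g0 : 0 < g by rewrite ltr_wpDl // mxl1_ge0.
exists (r^-1 * g) => [|L LS]; first by rewrite mulr_gt0 ?invr_gt0.
apply: le_trans (gradient_dominance Qpd Vpd r0 Vr LS L0S) _.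
rewrite -mulrA ler_pM2l ?invr_gt0 //; apply: tr_congr_le => x.
apply: le_trans (ler_norm _) _; apply: le_trans (qf_le_mxl1 _ _) _.
by rewrite /g mulrDl mul1r lerDl sqn_ge0.
Qed.

(** The 4 of the decay rate is the square of the factor 2 in the gradient. *)
Lemma grad_frob_ge (W : 'M[R]_n) (K : 'M[R]_(n, p)) (k : R) :
  psdmx W -> 0 <= k -> (forall x, k * sqn x <= qf W x) ->
  4 * k ^+ 2 * frob_dot K K <= frob_dot (- 2 *: (W *m K)) (- 2 *: (W *m K)).
Proof.
move=> Wp k0 kW.
have -> : frob_dot (- 2 *: (W *m K)) (- 2 *: (W *m K)) =
    4 * frob_dot (W *m K) (W *m K).
  rewrite !frob_dotE big_distrr; apply: eq_bigr => i _.
  by rewrite big_distrr; apply: eq_bigr => j _ /=; rewrite !mxE; ring.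
rewrite -mulrA ler_pM2l // !frob_dot_sqn big_distrr; apply: ler_sum => j _ /=.
have -> : col j (W *m K) = W *m col j K by rewrite !colE mulmxA.
exact: lambda_min_sqr.
Qed.

Variables (J : 'M[R]_(n, p) -> R) (L : R -> 'M[R]_(n, p)).
Hypothesis JE : forall X, S X -> J X = loss X.
Hypothesis flow : gradient_flow S J L.

Local Notation grad X := (- 2 *: (gramian X *m Kx X)).

Lemma flow_stable t : 0 <= t -> S (L t).
Proof. by move=> t0; have [] := flow t0. Qed.

(** Rate and level are left free: [a = 0] gives monotonicity, which confines the flow to the initial
    sublevel set; only then are the bounds valid on that set available for a positive rate. *)
Lemma flow_decay (a l : R) :
  (forall t, 0 <= t ->
     a * (loss (L t) - l) <= frob_dot (grad (L t)) (grad (L t))) ->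
  forall t, 0 <= t -> loss (L t) - l <= expR (- a * t) * (loss (L 0) - l).
Proof.
move=> aP.
have q (t : R) (t0 : 0 <= t) := @gradient_flow_quotient R n p S J L
  (slope A C Q V) (fun X => grad X) _ flow t t0.
have {}q t : 0 <= t ->
    (s - t)^-1 * (J (L s) - J (L t)) @[s --> within `[0, +oo[ (t^')] -->
      - frob_dot (grad (L t)) (grad (L t)).
  move=> t0; apply: q => // X XS; split; last exact: cvg_slope.
  (* [J] and [loss] are known to agree on stabilising gains only; these form an open set, so the
     secant identity transfers near [X]. *)
  near=> Y.
  have YS : S Y by near: Y; exact: stable_gains_near.
  rewrite (JE XS) (JE YS); near: Y; exact: loss_slope.
move=> t t0; rewrite -(JE (flow_stable t0)) -(JE (flow_stable (lexx 0))).
apply: (@half_gronwall R (fun s => J (L s) - l)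
  (fun s => - frob_dot (grad (L s)) (grad (L s))) a _ _ t t0) => s s0.
- under eq_cvg do rewrite opprB addrA subrK.
  exact: q.
- by rewrite mulNr lerN2 (JE (flow_stable s0)); exact: aP.
Unshelve. all: by end_near. Qed.

Lemma flow_loss_le t : 0 <= t -> loss (L t) <= loss (L 0).
Proof.
move=> t0; have h (s : R) : 0 <= s ->
    0 * (loss (L s) - 0) <= frob_dot (grad (L s)) (grad (L s)).
  by rewrite mul0r frob_dot_ge0.
have := flow_decay h t0.
by rewrite mulNr mul0r oppr0 expR0 mul1r lerD2r.
Qed.

(** The distance is controlled by [r k |L - L0|^2 <= J(L) - J(L0)], with [k] a lower bound of the
    Gramian on the sublevel set, so it inherits the decay of the loss. Any positive rate suffices
    here. *)
Lemma flow_cvg L0 : S L0 -> Kx L0 = 0 -> L t @[t --> +oo] --> L0.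
Proof.
move=> L0S K0; have L00S := flow_stable (lexx 0).
have [k k0 kP] := sublevel_gramian_lower L00S.
have [c c0 cP] := loss_gap_le L0S.
have [r r0 Vr] := pdmx_lower Vpd.
pose a := 4 * k ^+ 2 / c.
have a0 : 0 < a by rewrite divr_gt0 // mulr_gt0 // exprn_gt0.
have decay t : 0 <= t ->
    loss (L t) - loss L0 <= expR (- a * t) * (loss (L 0) - loss L0).
  apply: flow_decay => s s0; have LsS := flow_stable s0.
  apply: le_trans (grad_frob_ge _ (gramian_psd LsS) (ltW k0)
    (kP _ LsS (flow_loss_le s0))).
  rewrite /a -mulrA ler_wpM2l ?mulr_ge0 ?exprn_ge0 ?(ltW k0) //.
  by rewrite ler_pdivrMl //; exact: cP.
pose M := (loss (L 0) - loss L0) / (r * k).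
have rk0 : 0 < r * k by rewrite mulr_gt0.
have M0 : 0 <= M.
  by rewrite divr_ge0 ?(ltW rk0) // subr_ge0; exact: stationary_min.
have dist t : 0 <= t ->
    frob_dot (L t - L0) (L t - L0) <= M * expR (- (a * t)).
  move=> t0; have LtS := flow_stable t0.
  have [h _] := loss_lower Qpd Vpd r0 Vr L0S K0 LtS.
  have := @tr_congr_ge _ _ _ _ (L t - L0) k (kP _ LtS (flow_loss_le t0)).
  rewrite -(ler_pM2l r0) => h'.
  have := le_trans h' (le_trans h (decay t t0)).
  rewrite mulrA -ler_pdivlMl // => /le_trans; apply.
  rewrite mulNr /M; move: (expR _) (loss _ - loss _) (r * k)^-1 => x y z.
  by rewrite (_ : z * (x * y) = y * z * x) //; ring.
apply/cvg_mxP => i j; apply/cvgrPdist_lt => e e0.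
have : M * expR (- (a * t)) @[t --> +oo] --> M * 0.
  apply: cvgMr.
  have := cvg_comp _ _ (gt0_cvgMry a0 cvg_id) (@cvgr_expR R).
  exact.
rewrite mulr0 => /cvgr_lt/(_ (e ^+ 2)); rewrite exprn_gt0 // => /(_ isT) near_e.
near=> t.
have t0 : 0 <= t by near: t; exact: nbhs_pinfty_ge.
have : M * expR (- (a * t)) < e ^+ 2 by near: t.
have := entry_sqr_le_frob (L t - L0) i j => h1 h2.
have := le_lt_trans (le_trans h1 (dist t t0)) h2.
rewrite -(real_normK (num_real _)) ltr_sqr ?nnegrE ?(ltW e0) //.
by rewrite distrC !mxE.
Unshelve. all: by end_near. Qed.

End FlowConvergence.

Theorem theorem4p3 (R : realType) (d : measure_display)
    (Omega : measurableType d) (P : probability Omega R)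
    (n p : nat) (n_gt0 : (0 < n)%N)
    (A : 'M[R]_n) (C : 'M[R]_(p, n)) (Qw : 'M[R]_n) (Rv : 'M[R]_p)
    (w : nat -> Omega -> 'cV[R]_n) (v : nat -> Omega -> 'cV[R]_p)
    (x0 xhat0 : Omega -> 'cV[R]_n)
    (Qw_pd : pdmx Qw) (Rv_pd : pdmx Rv)
    (w_noise : iid_noise P w Qw) (v_noise : iid_noise P v Rv)
    (wv_indep : sigma_indep P (sigma_seq w) (sigma_seq v))
    (init : initial_data P x0 xhat0)
    (init_indep : indep_of_noises P x0 xhat0 w v)
    (obs : observable A (C *m A)) (stab : stabilizable A (sqrtmx Qw))
    (L : R -> 'M[R]_(n, p)) :
  let J := innovation_loss P A C w v x0 xhat0 in
  let LKF := kalman_gain P A C w v x0 xhat0 in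
  let kap := kappa P A C w v x0 xhat0 (L 0) in
  let c := gap_ratio P A C w v x0 xhat0 (L 0) in
  stable_gains A C (L 0) ->
  gradient_flow (stable_gains A C) J L ->
  [/\ L t @[t --> +oo] --> LKF,
      0 < kap /\ (c < +oo)%E &
      forall t, 0 <= t ->
        J (L t) - J LKF <=
          expR (- 4 * (kap ^+ 2 / fine c) * t) * (J (L 0) - J LKF)].
Proof.
move=> J LKF kap c L00S flow.
have JE X : stable_gains A C X -> J X = loss A C Qw Rv X.
  exact: innovation_lossE.
have KE X : stable_gains A C X ->
    cross_cov P A C w v x0 xhat0 X = Kx A C Qw Rv X.
  exact: cross_covE.
have mseE X : stable_gains A C X ->
    steady_mse P A C w v x0 xhat0 X = \tr (errcov A C Qw Rv X).
  exact: steady_mseE.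
have [L0 L0S K0] := kalman_gain_exists Qw_pd Rv_pd obs L00S.
(* The mean-square error is [tr P], of which [L0] is the only minimiser, so the choice made by
   [xget] is forced and its default is never reached. *)
have LKFE : LKF = L0.
  have : [set X | stable_gains A C X /\ forall X',
      stable_gains A C X' -> steady_mse P A C w v x0 xhat0 X <=
      steady_mse P A C w v x0 xhat0 X'] (kalman_gain P A C w v x0 xhat0).
    apply: (@xgetPex _ 0); exists L0; split; first exact: L0S.
    move=> X XS; rewrite (mseE L0 L0S) (mseE X XS).
    by have [] := errcov_tr_minimiser Qw_pd Rv_pd L0S K0 XS.
  rewrite /LKF; move: (kalman_gain _ _ _ _ _ _ _) => X [XS Xm].
  have [_] := errcov_tr_minimiser Qw_pd Rv_pd L0S K0 XS; apply.
  by have := Xm L0 L0S; rewrite (mseE X XS) (mseE L0 L0S).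
have subP X : sublevel P A C w v x0 xhat0 (L 0) X <->
    stable_gains A C X /\ loss A C Qw Rv X <= loss A C Qw Rv (L 0).
  split=> -[XS Xl]; split; try exact: XS.
    by rewrite -(JE X XS) -(JE _ L00S).
  by move: Xl; rewrite -(JE X XS) -(JE _ L00S).
have L00sub : sublevel P A C w v x0 xhat0 (L 0) (L 0) by split.
have [k k0 kP] := sublevel_gramian_lower Qw_pd Rv_pd obs L00S.
have WE X : stable_gains A C X -> obs_gramian A C X = gramian A C X.
  move=> XS; have [_] : [set W | psdmx W /\
      W = (closed_loop A C X)^T *m W *m closed_loop A C X +
        A^T *m C^T *m C *m A] (obs_gramian A C X).
    apply: (@xgetPex _ 0); exists (gramian A C X); split.
      exact: gramian_psd.
    by rewrite [LHS]gramianE // (trmx_mul C A) !mulmxA.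
  move=> h; apply: dlyap_unique; first exact/stable_trmx/stable_gain.
  by rewrite trmxK {1}h; congr (_ + _); rewrite (trmx_mul C A) !mulmxA.
have lamP X : stable_gains A C X ->
    eigenvalue (gramian A C X) (lambda_min (gramian A C X)) /\
    forall x, lambda_min (gramian A C X) * sqn x <= qf (gramian A C X) x.
  by move=> XS; apply: lambda_minP => //; exact: gramian_psd.
have lamk X : sublevel P A C w v x0 xhat0 (L 0) X ->
    k <= lambda_min (obs_gramian A C X).
  move=> /subP[XS Xl]; rewrite WE //.
  have [/eigenvalueP[u uW u0] _] := lamP X XS.
  have := kP X XS Xl u^T.
  have -> : qf (gramian A C X) u^T = lambda_min (gramian A C X) * sqn u^T.
    by rewrite /sqn /qf /bf trmxK uW mulmx1 -scalemxAl mxE.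
  rewrite ler_pM2r // sqn_gt0 //.
  by apply: contra_neq u0 => u0; rewrite -[u]trmxK u0 trmx0.
have kkap : k <= kap.
  apply: lb_le_inf; first by exists (lambda_min (obs_gramian A C (L 0))), (L 0).
  by move=> _ [X Xsub <-]; exact: lamk.
have kap0 : 0 < kap by exact: lt_le_trans kkap.
(* The stated rate involves [kap] itself; [k] serves to show that the infimum is taken over a set
   bounded below and is positive. *)
have kapW X : stable_gains A C X -> loss A C Qw Rv X <= loss A C Qw Rv (L 0) ->
    forall x, kap * sqn x <= qf (gramian A C X) x.
  move=> XS Xl x; have [_ h] := lamP X XS; apply: le_trans (h x).
  rewrite ler_wpM2r ?sqn_ge0 //; apply: ge_inf.
    by exists k => _ [Y Ysub <-]; exact: lamk.
  by exists X; [exact/subP|rewrite WE].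
have [c0 c00 c0P] := loss_gap_le Qw_pd Rv_pd L0S.
have Kfrob X : stable_gains A C X -> X != L0 ->
    0 < frob_dot (Kx A C Qw Rv X) (Kx A C Qw Rv X).
  move=> XS XL0; rewrite lt_def frob_dot_ge0 andbT.
  apply: contra_neq XL0 => /frob_dot_eq0 KX.
  exact: (stationary_unique Qw_pd Rv_pd L0S K0 XS KX).
pose ratio X := (loss A C Qw Rv X - loss A C Qw Rv L0) /
  frob_dot (Kx A C Qw Rv X) (Kx A C Qw Rv X).
have ratioE X : stable_gains A C X -> X != L0 ->
    ((J X - J LKF)%:E / (frob_norm (cross_cov P A C w v x0 xhat0 X) ^+ 2)%:E)%E
    = (ratio X)%:E.
  move=> XS XL0; rewrite LKFE !JE // KE // frob_normK inver.
  by rewrite gt_eqF ?Kfrob // -EFinM.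
have cc0 : (c <= c0%:E)%E.
  apply: ge_ereal_sup => _ [X [Xsub XL] <-]; have [XS _] := Xsub.
  have XL0 : X != L0 by apply/eqP => XL0; apply: XL; rewrite -/LKF LKFE.
  rewrite ratioE // lee_fin ler_pdivrMr ?Kfrob //; exact: c0P.
have coo : (c < +oo)%E by apply: le_lt_trans cc0 _; rewrite ltry.
have ratio_le X : stable_gains A C X ->
    loss A C Qw Rv X <= loss A C Qw Rv (L 0) ->
    X != L0 -> ((ratio X)%:E <= c)%E.
  move=> XS Xl XL0; rewrite -ratioE //; apply: ereal_sup_ubound.
  exists X; last exact: erefl.
  split; first by apply/subP.
  rewrite -/LKF LKFE; exact/eqP.
have ratio_ge0 X : stable_gains A C X -> 0 <= ratio X.
  move=> XS; rewrite divr_ge0 ?frob_dot_ge0 // subr_ge0.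
  exact: (stationary_min Qw_pd Rv_pd L0S K0 XS).
(* If the sublevel set is reduced to the Kalman gain, the supremum is over the empty set and [fine]
   sends its value [-oo] to 0. *)
have fc0 : 0 <= fine c.
  have [h|h] := pselect (exists2 X, sublevel P A C w v x0 xhat0 (L 0) X & X != L0).
    have [X /subP[XS Xl] XL0] := h; apply: fine_ge0.
    by apply: le_trans (ratio_le X XS Xl XL0); rewrite lee_fin ratio_ge0.
  rewrite (_ : c = -oo%E) // -ereal_sup0 /c /gap_ratio.
  apply: (congr1 (@ereal_sup R)); apply/seteqP; split; last exact: sub0set.
  move=> x [X [Xsub XL] _].
  exfalso; apply: h; exists X; first exact: Xsub.
  by apply/eqP => XL0; apply: XL; rewrite -/LKF LKFE.
have gap X : stable_gains A C X -> loss A C Qw Rv X <= loss A C Qw Rv (L 0) ->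
    loss A C Qw Rv X - loss A C Qw Rv L0 <=
      fine c * frob_dot (Kx A C Qw Rv X) (Kx A C Qw Rv X).
  move=> XS Xl; have [->|XL0] := eqVneq X L0.
    by rewrite subrr mulr_ge0 // frob_dot_ge0.
  have rc := ratio_le X XS Xl XL0.
  rewrite -ler_pdivrMr ?Kfrob // -/(ratio X) -lee_fin fineK //.
  by rewrite fin_numElt coo andbT; apply: lt_le_trans rc; rewrite ltNyr.
split=> [||t t0].
- by rewrite LKFE; exact: (flow_cvg Qw_pd Rv_pd obs JE flow L0S K0).
- by split.
rewrite LKFE (JE L0 L0S) (JE _ L00S) (JE _ (flow_stable flow t0)).
rewrite mulNr; apply: (flow_decay Qw_pd Rv_pd JE flow) => // s s0.
have LsS := flow_stable flow s0.
have Lsl := flow_loss_le Qw_pd Rv_pd JE flow s0.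
apply: le_trans (grad_frob_ge _ (gramian_psd LsS) (ltW kap0) (kapW _ LsS Lsl)).
(* Division by 0 gives 0, so the rate is 0 here and only the non-negativity of [4 kap^2 |K|^2]
   remains to be shown. *)
have [->|fc] := eqVneq (fine c) 0.
  by rewrite invr0 !mulr0 mul0r !mulr_ge0 ?exprn_ge0 ?frob_dot_ge0 // ltW.
have {}fc : 0 < fine c by rewrite lt_def fc.
rewrite !mulrA -[leLHS]mulrA ler_wpM2l ?mulr_ge0 ?exprn_ge0 ?(ltW kap0) //.
by rewrite ler_pdivrMl //; exact: gap.
Qed.
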